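(* There exist universal constants $0<c\le C<\infty$ such that the following holds for all integers $n\ge d\ge 3$. For every $\delta\in(0,1/e]$, $$c\Big(d\log\frac{en}{d}+\log\frac1\delta\Big)\le \mathcal Q^{\mathsf{RD}}_{1-\delta}(n,d)\le C\Big(d\log\frac{en}{d}+\log\frac1\delta\Big)$$ and $$c\Big(d\log\frac{en}{d}+\log\frac1\delta\Big)\le \mathcal Q^{\mathsf{FD}}_{1-\delta}(n,d)\le C\Big(d\log\frac{en}{d}+\log\frac1\delta\Big).$$ In particular, $$c\, d\log\frac{en}{d}\le \mathcal E^{\mathsf{RD}}(n,d)\le C\, d\log\frac{en}{d}\quad\text{and}\quad c\, d\log\frac{en}{d}\le \mathcal E^{\mathsf{FD}}(n,d)\le C\, d\log\frac{en}{d}.$$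
   Context: Let $\sigma(t)=1/(1+e^{-t})$. In the logistic model with covariates $x_1,\dots,x_n\in\mathbb R^d$ and parameter $\theta^\star\in\mathbb R^d$, the labels $Y_1,\dots,Y_n\in\{-1,1\}$ are independent with $\mathbf P(Y_i=1)=\sigma(\langle x_i,\theta^\star\rangle)$. The log-likelihood ratio statistic is $$\Lambda_n^{\log}(\theta^\star;x_{1:n};Y_{1:n})=\log\frac{\sup_{\theta\in\mathbb R^d}\prod_{i=1}^n\sigma(Y_i\langle x_i,\theta\rangle)}{\prod_{i=1}^n\sigma(Y_i\langle x_i,\theta^\star\rangle)}.$$ For a real random variable $Z$ and $\delta\in(0,1)$, $\mathsf Q_{1-\delta}(Z)=\inf\{z\in\mathbb R:\mathbf P(Z\le z)\ge 1-\delta\}$. Fixed design: $$\mathcal E^{\mathsf{FD}}(n,d)=\sup_{x_1,\dots,x_n\in\mathbb R^d,\ \theta^\star\in\mathbb R^d}\mathbf E\,\Lambda_n^{\log}(\theta^\star;x_{1:n};Y_{1:n}),\qquad \mathcal Q^{\mathsf{FD}}_{1-\delta}(n,d)=\sup_{x_1,\dots,x_n\in\mathbb R^d,\ \theta^\star\in\mathbb R^d}\mathsf Q_{1-\delta}\big(\Lambda_n^{\log}(\theta^\star;x_{1:n};Y_{1:n})\big),$$ where the randomness is over $Y_{1:n}$. Random design: $$\mathcal E^{\mathsf{RD}}(n,d)=\sup_{\theta^\star\in\mathbb R^d,\,P}\mathbf E\,\Lambda_n^{\log}(\theta^\star;X_{1:n};Y_{1:n}),\qquad \mathcal Q^{\mathsf{RD}}_{1-\delta}(n,d)=\sup_{\theta^\star\in\mathbb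 R^d,\,P}\mathsf Q_{1-\delta}\big(\Lambda_n^{\log}(\theta^\star;X_{1:n};Y_{1:n})\big),$$ where $P$ ranges over all probability measures on $\mathbb R^d$, $X_1,\dots,X_n$ are i.i.d. from $P$, and conditionally on $X_{1:n}$ the labels $Y_{1:n}$ follow the logistic model with covariates $X_{1:n}$ and parameter $\theta^\star$; the randomness is over $(X_{1:n},Y_{1:n})$. *)

(* Defs.v *)
From HB Require Import structures.
From mathcomp Require Import all_boot all_order all_algebra.
From mathcomp Require Import all_classical all_reals all_analysis.
From mathcomp Require Import measurable_realfun.

Set Implicit Arguments.
Unset Strict Implicit.
Unset Printing Implicit Defensive.

Import Order.TTheory GRing.Theory Num.Theory.
Import numFieldNormedType.Exports.

Local Open Scope classical_set_scope.
Local Open Scope ring_scope.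
Local Open Scope ereal_scope.

Section semidirect.
Context d1 d2 (X : measurableType d1) (Y : measurableType d2) (R : realType).
Variables (P : probability X R) (k : R.-pker X ~> Y).

Definition semidirect (A : set (X * Y)) : \bar R :=
  \int[P]_x k x (xsection A x).

Let semidirect0 : semidirect set0 = 0.
Proof. by apply: integral0_eq => x _; rewrite xsection0 measure0. Qed.

Let semidirect_ge0 A : 0 <= semidirect A.
Proof. exact: integral_ge0. Qed.

Let semidirect_sigma_additive : semi_sigma_additive semidirect.
Proof.
move=> F mF tF mUF.
rewrite [X in _ --> X](_ : _ = \sum_(n <oo) semidirect (F n)).
  by apply/cvg_closeP; split; [exact: is_cvg_nneseries|rewrite closeE].
rewrite -integral_nneseries//; last first.
  by move=> n; apply: measurable_fun_xsection_finite_kernel; rewrite inE.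
apply: eq_integral => x _; apply/esym/cvg_lim => //=; rewrite xsection_bigcup.
apply: (measure_sigma_additive _ (trivIset_xsection tF)) => ?.
exact: measurable_xsection.
Qed.

HB.instance Definition _ := isMeasure.Build _ _ _ semidirect
  semidirect0 semidirect_ge0 semidirect_sigma_additive.

Let semidirect_setT : semidirect setT = 1.
Proof.
rewrite /semidirect; under eq_integral.
  move=> x _; rewrite (_ : xsection _ _ = setT); last first.
    by apply/seteqP; split => y // _; rewrite /xsection/= inE.
  rewrite prob_kernel; over.
by rewrite integral_cst// mul1e; exact: probability_setT.
Qed.

HB.instance Definition _ :=
  Measure_isProbability.Build _ _ _ semidirect semidirect_setT.

End semidirect.

Section product_probability.
Context d1 d2 (T1 : measurableType d1) (T2 : measurableType d2) (R : realType).
Variables (P1 : probability T1 R) (P2 : probability T2 R).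

Definition prod_prob : set (T1 * T2) -> \bar R := P1 \x P2.

HB.instance Definition _ := Measure.on prod_prob.

Let prod_prob_setT : prod_prob setT = 1.
Proof.
rewrite /prod_prob -setXTT product_measure1E//.
by rewrite -[RHS]mule1; congr (_ * _); exact: probability_setT.
Qed.

HB.instance Definition _ :=
  Measure_isProbability.Build _ _ _ prod_prob prod_prob_setT.

End product_probability.

Section product_tuple.
Context d (T : measurableType d) (R : realType).

Definition tcons n (xt : T * n.-tuple T) : n.+1.-tuple T :=
  [tuple of xt.1 :: xt.2].

Let measurable_tcons n : measurable_fun [set: _] (@tcons n).
Proof. exact: measurable_cons. Qed.

HB.instance Definition _ n :=
  isMeasurableFun.Build _ _ _ _ (@tcons n) (@measurable_tcons n).

(* Law of a tuple of independent variables with laws [p 0], ..., [p (n - 1)];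
   see [prod_tuple_rect]. *)
Fixpoint prod_tuple n : ('I_n -> probability T R) ->
    probability (n.-tuple T) R :=
  match n with
  | 0 => fun=> dirac [tuple]
  | n'.+1 => fun p => distribution
      (prod_prob (p ord0) (prod_tuple (fun i => p (lift ord0 i))))
      (@tcons n')
  end.

Lemma prod_tuple_rect n (p : 'I_n -> probability T R) (A : 'I_n -> set T) :
    (forall i, measurable (A i)) ->
  prod_tuple p [set t | forall i, A i (tnth t i)] = \prod_(i < n) p i (A i).
Proof.
elim: n => [|n IH] in p A *.
  by move=> _; rewrite big_ord0/= diracE mem_set// => -[].
move=> mA; rewrite big_ord_recl/= /distribution/= /pushforward.
rewrite [X in prod_prob _ _ X](_ : _ = A ord0 `*`
    [set t | forall i, A (lift ord0 i) (tnth t i)]); last first.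
  apply/seteqP; split => -[x t]/=.
    move=> At; split; first by have := At ord0; rewrite tnth0.
    by move=> i; have := At (lift ord0 i); rewrite tnthS.
  move=> [Ax At] i; case: (unliftP ord0 i) => [j|] ->.
    by rewrite tnthS.
  by rewrite tnth0.
rewrite /prod_prob product_measure1E//; first by congr (_ * _); exact: IH.
rewrite (_ : [set _ | _] = \bigcap_(i in [set: 'I_n])
    ((@tnth _ T)^~ i @^-1` A (lift ord0 i))).
  apply: fin_bigcap_measurable => // i _.
  by rewrite -[X in measurable X]setTI; exact: measurable_tnth.
by apply/seteqP; split => t /= h i; [move=> _|]; exact: h.
Qed.

End product_tuple.

Section measurable_prod_tuple.
Context d d' (T : measurableType d) (X : measurableType d') (R : realType).

Lemma measurable_pprobability (P : X -> pprobability T R) :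
  (forall U, measurable U -> measurable_fun setT (fun x => P x U)) ->
  measurable_fun setT P.
Proof.
move=> mP; apply: (measurability (@pset _ _ _ : set (set (pprobability T R)))) => //.
move=> _ -[_ [r r01] [Ys mYs <-]] <-; apply: emeasurable_fun_infty_o => //=.
exact: mP.
Qed.

End measurable_prod_tuple.

Lemma measurable_prod_tuple d d' (T : measurableType d) (X : measurableType d')
    (R : realType) n (p : X -> 'I_n -> pprobability T R) :
  (forall i, measurable_fun setT (p ^~ i)) ->
  measurable_fun setT (fun x => prod_tuple (p x) : pprobability (n.-tuple T) R).
Proof.
elim: n => [|n IH] in p *.
  move=> _; apply: measurable_pprobability => U mU; exact: measurable_cst.
move=> mp; apply: measurable_pprobability => U mU /=.
rewrite /distribution/= /pushforward /prod_prob /product_measure1 /=.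
pose q (x : X * T) : pprobability (n.-tuple T) R :=
  prod_tuple (fun i => p x.1 (lift ord0 i)).
have mq : measurable_fun setT q.
  exact: (measurableT_comp (IH (fun x i => p x (lift ord0 i)) _)).
pose V := @tcons _ T n @^-1` U.
have mV : measurable V.
  rewrite -[V]setTI.
  exact: (measurable_funPT (@tcons _ T n)).
pose h (z : (X * T) * n.-tuple T) := (z.1.2, z.2).
have mh : measurable_fun setT h.
  apply: measurable_fun_pair; last exact: measurable_snd.
  by apply: measurableT_comp; [exact: measurable_snd|exact: measurable_fst].
pose W := h @^-1` V.
have mW : measurable W by rewrite -[W]setTI; exact: mh.
apply: (measurable_fun_integral_finite_kernel
  (fun z : X * T => kprobability mq z (xsection W z))
  (kprobability (mp ord0))) => //.
by apply: measurable_fun_xsection_finite_kernel; rewrite inE.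
Qed.

(* The infimum is taken in the extended reals, so that it is +oo on the empty
   set. *)
Definition quantile d (T : measurableType d) (R : realType)
    (P : probability T R) (q : R) (Z : T -> R) : \bar R :=
  ereal_inf [set z%:E | z in [set z : R | q%:E <= P [set t | (Z t <= z)%R]]].

(* R^d is [d.-tuple R], whose product sigma-algebra is the Borel one. *)
Section logistic.
Local Open Scope ring_scope.
Context {R : realType} {n d : nat}.
Implicit Types (theta : d.-tuple R) (x : n.-tuple (d.-tuple R)).
Implicit Types (y : n.-tuple bool) (P : probability (d.-tuple R) R).

Definition sigmoid (t : R) : R := 1 / (1 + expR (- t)).

Definition dot (u v : d.-tuple R) : R := \sum_(j < d) tnth u j * tnth v j.

(* Labels in {-1, 1} are encoded as booleans, [true] standing for 1. *)
Definition label (b : bool) : R := if b then 1 else -1.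

Definition likelihood theta x y : R :=
  \prod_(i < n) sigmoid (label (tnth y i) * dot (tnth x i) theta).

Definition log_lr theta x y : R :=
  ln (sup (range (fun theta' => likelihood theta' x y)) / likelihood theta x y).

Definition label_law theta x : probability (n.-tuple bool) R :=
  prod_tuple (fun i => bernoulli_prob (sigmoid (dot (tnth x i) theta))).

Lemma measurable_sigmoid : measurable_fun setT sigmoid.
Proof.
apply: continuous_measurable_fun => t; apply: cvgM; first exact: cvg_cst.
apply: cvgV; first by rewrite gt_eqF// addr_gt0// expR_gt0.
apply: cvgD; first exact: cvg_cst.
by apply: continuous_comp; [exact: opp_continuous|exact: continuous_expR].
Qed.

Lemma measurable_label_law theta :
  measurable_fun setT (label_law theta : _ -> pprobability (n.-tuple bool) R).
Proof.
apply: measurable_prod_tuple => i.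
apply: (measurableT_comp measurable_bernoulli_prob).
have mdot : measurable_fun setT (fun x => dot (tnth x i) theta).
  apply: measurable_sum => j; apply: measurable_funM => //.
  by apply: (measurableT_comp (measurable_tnth j)); exact: measurable_tnth.
apply: (measurableT_comp measurable_sigmoid); exact: mdot.
Qed.

(* Law of the labelled sample: the covariates are i.i.d. with law [P] and,
   given the covariates [x], the labels have law [label_law theta x]. *)
Definition sample_law theta P :
    probability (n.-tuple (d.-tuple R) * n.-tuple bool)%type R :=
  semidirect (prod_tuple (fun=> P)) (kprobability (measurable_label_law theta)).

End logistic.

Section minimax.
Context {R : realType} (n d : nat).

Definition E_FD : \bar R := ereal_sup [set e : \bar R | exists
  (x : n.-tuple (d.-tuple R)) (theta : d.-tuple R),
  e = 'E_(label_law theta x)[log_lr theta x]].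

Definition Q_FD (q : R) : \bar R := ereal_sup [set e : \bar R | exists
  (x : n.-tuple (d.-tuple R)) (theta : d.-tuple R),
  e = quantile (label_law theta x) q (log_lr theta x)].

Definition E_RD : \bar R := ereal_sup [set e : \bar R | exists
  (theta : d.-tuple R) (P : probability (d.-tuple R) R),
  e = 'E_(sample_law theta P)
        [fun xy : n.-tuple _ * n.-tuple bool => log_lr theta xy.1 xy.2]].

Definition Q_RD (q : R) : \bar R := ereal_sup [set e : \bar R | exists
  (theta : d.-tuple R) (P : probability (d.-tuple R) R),
  e = quantile (sample_law theta P) q
        (fun xy : n.-tuple _ * n.-tuple bool => log_lr theta xy.1 xy.2)].

End minimax.

(* Main.v *)
(* Upper bounds.  By Markov's inequality and Jensen's inequality applied to
   [exp Lambda], whose expectation is the Shtarkov sum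
   [\sum_y sup_theta L(theta; y)], it suffices to bound that sum by
   [(e n / d) ^ d].  Realize the label [y_i] as the event
   [U_i < sigmoid <x_i, theta>] with [U_i] independent uniform variables that
   do not depend on [theta]: the sum is then at most the expected number of
   patterns [(U_i < sigmoid <x_i, theta>)_i], [theta] in [R^d], which is at
   most [\sum_(k <= d) 'C(n, k)] by Sauer-Shelah.  The bounds hold
   conditionally on the design, hence also for a random design.

   Lower bounds.  Put the covariates on the moment curve
   [(1, t, .., t ^ (d - 1))] with [t] uniform, and let [theta] have only an
   intercept, so that every label is [false] with the same small probability
   [p].  If fewer than [d / 2] labels are [false], the polynomial
   [\prod_j (X - t_j) ^ 2 - e] separates them from the others, so that the
   maximal likelihood is 1 and [Lambda] is at least [log (1 / p)] times the
   number of [false] labels; take [p] of order [d / n].  The term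
   [log (1 / delta)] comes from the event that all labels are [false], with
   [p] such that it has probability slightly more than [delta].  A random
   design lower bound yields one for some fixed design. *)

From HB Require Import structures.
Require Import Defs.
From mathcomp Require Import all_boot all_order all_algebra.
From mathcomp Require Import all_classical all_reals all_analysis.
From mathcomp Require Import measurable_realfun zify ring lra.

Set Implicit Arguments.
Unset Strict Implicit.
Unset Printing Implicit Defensive.

Import Order.TTheory GRing.Theory Num.Theory.
Import numFieldNormedType.Exports.

Local Open Scope ring_scope.

(** * Sauer-Shelah bound for linear threshold patterns *)

Section shattering.
Variable T : finType.
Implicit Types (F : {set {set T}}) (S : {set T}).

Definition shatters F S :=
  [forall B : {set T}, (B \subset S) ==> [exists A in F, A :&: S == B]].

Lemma shattersP F S :
  reflect (forall B : {set T}, B \subset S -> exists2 A, A \in F & A :&: S = B)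
          (shatters F S).
Proof.
apply: (iffP forallP) => [h B BS|h B].
  by have /implyP/(_ BS)/exists_inP[A AF /eqP] := h B; exists A.
by apply/implyP => /h[A AF e]; apply/exists_inP; exists A => //; exact/eqP.
Qed.

Definition shattered F := [set S | shatters F S].

Lemma sub_shatters F F' S : F \subset F' -> shatters F S -> shatters F' S.
Proof.
move=> /fintype.subsetP FF' /shattersP h; apply/shattersP => B /h[A AF e].
by exists A => //; exact: FF'.
Qed.

(* Pajor's strengthening of the Sauer-Shelah lemma. *)
Lemma card_shattered F : (#|F| <= #|shattered F|)%N.
Proof.
have [m] := ubnP #|F|; elim: m F => // m IH F /ltnSE Fm.
have [/card_le1_eqP F1|] := leqP #|F| 1.
  have [->|[A AF]] := finset.set_0Vmem F; first by rewrite cards0.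
  have -> : F = [set A].
    by apply/setP => B; rewrite inE; apply/idP/eqP => [BF|->//]; exact: F1.
  rewrite cards1 card_gt0; apply/set0Pn; exists finset.set0.
  rewrite inE; apply/shattersP => B; rewrite finset.subset0 => /eqP ->.
  by exists A; rewrite ?inE// finset.setI0.
move=> /card_gt1P[A [B [AF BF AB]]].
have [x xAB] : exists x, (x \in A) != (x \in B).
  apply/existsP; apply: contraR AB; rewrite negb_exists => /forallP h.
  by apply/eqP/setP => x; have := h x; rewrite negbK => /eqP.
pose F1 := [set C in F | x \in C]; pose F0 := [set C in F | x \notin C].
have cF : (#|F1| + #|F0|)%N = #|F|.
  rewrite -(finset.cardsID [set C : {set T} | x \in C] F); congr (_ + _)%N;
    by apply: eq_card => C; rewrite !inE// andbC.
have F1_gt0 : (0 < #|F1|)%N.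
  rewrite card_gt0; apply/set0Pn; have [xA|xA] := boolP (x \in A).
    by exists A; rewrite inE AF.
  exists B; rewrite inE BF; move: xAB; rewrite (negbTE xA).
  by case: (x \in B).
have F0_gt0 : (0 < #|F0|)%N.
  rewrite card_gt0; apply/set0Pn; have [xA|xA] := boolP (x \in A).
    by exists B; rewrite inE BF; move: xAB; rewrite xA; case: (x \in B).
  by exists A; rewrite inE AF.
have IH1 : (#|F1| <= #|shattered F1|)%N.
  by apply: IH; apply: leq_trans Fm; rewrite -cF -ltn_subLR// subnn.
have IH0 : (#|F0| <= #|shattered F0|)%N.
  by apply: IH; apply: leq_trans Fm; rewrite -cF addnC -ltn_subLR// subnn.
(* All members of [F1] contain [x], so if [x] were in [S] the empty trace would be missed. Dually,
   no member of [F0] could have the full trace [S]. *)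
have x1 S : shatters F1 S -> x \notin S.
  move=> /shattersP/(_ _ (finset.sub0set S))[C]; rewrite inE => /andP[_ xC] CS.
  by apply/negP => xS; have := finset.in_set0 x; rewrite -CS inE xC xS.
have x0 S : shatters F0 S -> x \notin S.
  move=> /shattersP/(_ _ (subxx S))[C]; rewrite inE => /andP[_ xC] CS.
  by apply/negP; rewrite -CS inE (negbTE xC).
(* A set [S] shattered by both halves is counted twice. The second count is paid by [x |: S], which
   [F] also shatters: choosing the half decides whether [x] belongs to the trace. *)
pose I := shattered F1 :&: shattered F0.
pose J := [set x |: S | S in I].
have cJ : #|J| = #|I|.
  apply: card_in_imset => S S'; rewrite !inE.
  move=> /andP[/x1 xS _] /andP[/x1 xS' _].
  by move=> /(congr1 (fun U => U :\ x)); rewrite !finset.setU1K.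
have dJ : [disjoint shattered F1 :|: shattered F0 & J].
  rewrite -finset.setI_eq0; apply/eqP/setP => S; rewrite !inE.
  apply/negbTE/negP => /andP[h /imsetP[S' _ SE]].
  have : x \in S by rewrite SE finset.setU11.
  by case/orP: h => [/x1|/x0] /negbTE ->.
have sJ : (shattered F1 :|: shattered F0) :|: J \subset shattered F.
  apply/fintype.subsetP => S; rewrite inE => /orP[|/imsetP[S' + ->]].
    rewrite !inE => /orP[]; apply: sub_shatters; apply/fintype.subsetP => C;
    by rewrite inE => /andP[].
  rewrite !inE => /andP[s1 s0]; apply/shattersP => C CS.
  have xS' := x1 _ s1.
  have CxS : C :\ x \subset S' by rewrite finset.subDset.
  have [xC|xC] := boolP (x \in C).
    have [A' + A'C] := shattersP _ _ s1 _ CxS.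
    rewrite inE => /andP[A'F xA']; exists A' => //.
    rewrite finset.setIUr A'C -[RHS](finset.setD1K xC); congr (_ :|: _).
    by apply/finset.setIidPr; rewrite finset.sub1set.
  have [A' + A'C] := shattersP _ _ s0 _ CxS.
  rewrite inE => /andP[A'F xA']; exists A' => //.
  rewrite finset.setIUr A'C.
  rewrite (_ : A' :&: [set x] = finset.set0) ?finset.set0U.
    by apply/setP => y; rewrite !inE; case: eqP => // ->; rewrite (negbTE xC).
  apply/setP => y; rewrite !inE andbC; case: eqP => // ->.
  by rewrite (negbTE xA').
have := subset_leq_card sJ.
rewrite cardsU (finset.disjoint_setI0 dJ) cards0 subn0 cJ cardsUI.
by apply: leq_trans; rewrite -cF leq_add.
Qed.

Lemma sauer_shelah F d : (forall S, shatters F S -> #|S| <= d)%N ->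
  (#|F| <= \sum_(k < d.+1) 'C(#|T|, k))%N.
Proof.
move=> Fd; apply: (leq_trans (card_shattered F)).
apply: (@leq_trans #|[set S : {set T} | (#|S| < d.+1)%N]|).
  by apply: subset_leq_card; apply/fintype.subsetP => S; rewrite !inE => /Fd.
rewrite -sum1_card.
rewrite (partition_big (fun S : {set T} => inord #|S| : 'I_d.+1) xpredT) //=.
apply: leq_sum => k _; rewrite -card_draws sum1_card.
apply: subset_leq_card; apply/fintype.subsetP => S.
by rewrite unfold_in !inE => /andP[Sd /eqP <-]; rewrite inordK.
Qed.

End shattering.

(* Two patterns that are separated exactly along the signs of a linear
   dependency of the rows cannot both be realized, whence at most [d] rows are
   shattered. *)
Lemma card_threshold_shatters (R : realFieldType) n d (g : R -> R)
    (X : 'M[R]_(n, d)) (u : 'I_n -> R) (F : {set {set 'I_n}}) (S : {set 'I_n}) :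
    {homo g : s t / s <= t} ->
    (forall A, A \in F -> exists v : 'cV_d, forall i,
       (i \in A) = (u i < g ((X *m v) i ord0))) ->
  shatters F S -> (#|S| <= d)%N.
Proof.
move=> gle Fu /shattersP shS; rewrite leqNgt; apply/negP => dS.
pose M := rowsub (@enum_val _ (mem S)) X.
have : kermx M != 0.
  by rewrite kermx_eq0 -row_leq_rank -ltnNge (leq_ltn_trans (rank_leq_col _)).
case/rowV0Pn => w /sub_kermxP wM /rV0Pn[k wk].
(* The row vector [w] is a nonzero dependency between the rows in [S]. Shattering realizes its
   positive support by [A] and its negative support by [B]. *)
have [A AF AS] : exists2 A, A \in F &
    A :&: S = [set enum_val i | i : 'I_#|S| & 0 < w ord0 i].
  by apply: shS; apply/fintype.subsetP => _ /imsetP[i _ ->]; exact: enum_valP.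
have [B BF BS] : exists2 B, B \in F &
    B :&: S = [set enum_val i | i : 'I_#|S| & w ord0 i < 0].
  by apply: shS; apply/fintype.subsetP => _ /imsetP[i _ ->]; exact: enum_valP.
have [a aE] := Fu _ AF; have [b bE] := Fu _ BF.
have inA i : (enum_val i \in A) = (0 < w ord0 i).
  have /setP/(_ (enum_val i)) := AS; rewrite inE enum_valP andbT => ->.
  by rewrite mem_imset ?inE//; exact: enum_val_inj.
have inB i : (enum_val i \in B) = (w ord0 i < 0).
  have /setP/(_ (enum_val i)) := BS; rewrite inE enum_valP andbT => ->.
  by rewrite mem_imset ?inE//; exact: enum_val_inj.
have gt s t c : c < g s -> ~~ (c < g t) -> t < s.
  rewrite -leNgt => cs tc; rewrite ltNge; apply/negP => /gle st.
  by have := lt_le_trans cs (le_trans st tc); rewrite ltxx.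
(* Monotonicity of [g] makes each term nonnegative, and positive where [w] is nonzero, whereas the
   terms sum to [w *m M *m (a - b) = 0]. *)
pose f i := w ord0 i * ((M *m (a - b)) i ord0).
have ME v i : (M *m v) i ord0 = (X *m v) (enum_val i) ord0.
  by rewrite !mxE; apply: eq_bigr => j _; rewrite mxE.
have f_gt0 i : w ord0 i != 0 -> 0 < f i.
  move=> wi; rewrite /f mulmxBr mxE [X in _ + X]mxE !ME.
  case: (ltgtP (w ord0 i) 0) wi => // wi _.
    rewrite nmulr_rgt0// subr_lt0; apply: (@gt _ _ (u (enum_val i))).
      by rewrite -bE inB.
    by rewrite -aE inA -leNgt ltW.
  rewrite pmulr_rgt0// subr_gt0; apply: (@gt _ _ (u (enum_val i))).
    by rewrite -aE inA.
  by rewrite -bE inB -leNgt ltW.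
have f_ge0 i : 0 <= f i.
  by have [w0|/f_gt0/ltW//] := eqVneq (w ord0 i) 0; rewrite /f w0 mul0r.
have : 0 < \sum_i f i.
  rewrite (bigD1 k)//=; apply: ltr_wpDr (f_gt0 _ wk).
  by apply: sumr_ge0 => i _.
suff -> : \sum_i f i = (w *m (M *m (a - b))) ord0 ord0.
  by rewrite mulmxA wM mul0mx mxE ltxx.
by rewrite mxE.
Qed.

(** With [q = d / n <= 1], multiplying by [q ^ d] bounds the sum by that of ['C(n, k) q ^ k], hence
    by [(1 + q) ^ n <= e ^ (q n) = e ^ d]. *)
Lemma sum_bin_le (R : realType) n d : (0 < d)%N -> (d <= n)%N ->
  (\sum_(k < d.+1) 'C(n, k))%:R <=
  expR (d%:R * ln (expR 1 * n%:R / d%:R)) :> R.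
Proof.
move=> d0 dn; have n0 := leq_trans d0 dn.
have dR : 0 < d%:R :> R by rewrite ltr0n.
have nR : 0 < n%:R :> R by rewrite ltr0n.
set q : R := d%:R / n%:R.
have q0 : 0 < q by rewrite divr_gt0.
have q1 : q <= 1 by rewrite ler_pdivrMr// mul1r ler_nat.
have -> : expR (d%:R * ln (expR 1 * n%:R / d%:R)) = expR 1 ^+ d / q ^+ d :> R.
  rewrite mulrC expRM_natr lnK ?posrE ?divr_gt0 ?mulr_gt0 ?expR_gt0//.
  by rewrite -expr_div_n /q invf_div mulrA.
rewrite ler_pdivlMr ?exprn_gt0// natr_sum mulr_suml.
apply: (@le_trans _ _ ((1 + q) ^+ n)); last first.
  apply: (@le_trans _ _ (expR q ^+ n)).
    by rewrite lerXn2r ?nnegrE ?expR_ge0 ?addr_ge0 ?(ltW q0)// expR_ge1Dx.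
  by rewrite -!expRM_natr mul1r /q divfK ?gt_eqF.
rewrite exprDn -(big_mkord xpredT (fun i => 1 ^+ (n - i) * q ^+ i *+ 'C(n, i))).
rewrite (@big_cat_nat _ _ _ d.+1)//= big_mkord -[leLHS]addr0 lerD//.
  apply: ler_sum => k _; rewrite expr1n mul1r -[leRHS]mulr_natl ler_wpM2l//.
  by apply: ler_wiXn2l; [exact: ltW|exact: q1|rewrite -ltnS].
by apply: sumr_ge0 => k _; rewrite expr1n mul1r mulrn_wge0// exprn_ge0// ltW.
Qed.

(** * The likelihood *)

Section sigmoid.
Context {R : realType}.
Implicit Types t : R.

Lemma sigmoidE t : sigmoid t = (1 + expR (- t))^-1.
Proof. by rewrite /sigmoid mul1r. Qed.

Lemma sigmoid_gt0 t : 0 < sigmoid t.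
Proof. by rewrite sigmoidE invr_gt0 addr_gt0// expR_gt0. Qed.

Lemma sigmoidN t : sigmoid (- t) = 1 - sigmoid t.
Proof.
rewrite !sigmoidE opprK expRN; have := expR_gt0 t; move: (expR t) => e.
by move=> e0; field; apply/andP; split; rewrite gt_eqF//; lra.
Qed.

Lemma sigmoid_lt1 t : sigmoid t < 1.
Proof. by rewrite -subr_gt0 -sigmoidN sigmoid_gt0. Qed.

Lemma sigmoid_homo : {homo @sigmoid R : s t / s <= t}.
Proof.
move=> s t st; rewrite !sigmoidE lef_pV2 ?posrE ?addr_gt0 ?expR_gt0//.
by rewrite lerD2l ler_expR lerN2.
Qed.

Lemma sigmoid_label b t :
  sigmoid (label b * t) = if b then sigmoid t else 1 - sigmoid t.
Proof. by case: b; rewrite /label ?mul1r// mulN1r sigmoidN. Qed.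

Lemma sigmoid_logit (p : R) : 0 < p -> p < 1 -> sigmoid (ln (p / (1 - p))) = p.
Proof.
move=> p0 p1; rewrite sigmoidE -lnV ?posrE ?divr_gt0 ?subr_gt0//.
rewrite invf_div lnK ?posrE ?divr_gt0 ?subr_gt0//.
have p'0 : p != 0 by rewrite gt_eqF.
by field; rewrite p'0/=; apply/eqP; lra.
Qed.

End sigmoid.

Lemma measurable_tuple_rect d (T : measurableType d) n (A : 'I_n -> set T) :
  (forall i, measurable (A i)) ->
  measurable [set t : n.-tuple T | forall i, A i (tnth t i)]%classic.
Proof.
move=> mA; rewrite (_ : mkset _ =
    \bigcap_(i in [set: 'I_n]) ((@tnth n T)^~ i @^-1` A i))%classic.
  apply: fin_bigcap_measurable => // i _.
  by rewrite -[X in measurable X]setTI; exact: measurable_tnth.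
by apply/seteqP; split => t h i; [move=> _|]; exact: h.
Qed.

Section tuple_bool.
Context {R : realType} {n : nat}.
Local Open Scope classical_set_scope.

Lemma measurable_tuple_bool (A : set (n.-tuple bool)) : measurable A.
Proof.
have m1 (y : n.-tuple bool) : measurable [set y].
  rewrite (_ : [set y] = [set z | forall i, [set tnth y i] (tnth z i)]).
    exact: (@measurable_tuple_rect _ _ _ (fun i => [set tnth y i])).
  apply/seteqP; split => [z -> i//|z zy].
  by apply/eq_from_tnth => i; exact: zy.
rewrite -[A]image_id -bigcup_imset1.
by apply: fin_bigcup_measurable => // ; exact: finite_finset.
Qed.

Lemma integral_tuple_bool (P : probability (n.-tuple bool) R)
    (f : n.-tuple bool -> \bar R) : (forall y, 0 <= f y)%E ->
  (\int[P]_y f y = \sum_y f y * P [set y])%E.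
Proof.
move=> f0.
have mf (g : n.-tuple bool -> \bar R) : measurable_fun setT g.
  by move=> _ Y _; exact: measurable_tuple_bool.
transitivity (\int[P]_y \sum_z f z * (\1_[set z] y)%:E)%E.
  apply: eq_integral => y _; rewrite (bigD1 y)//= big1 => [|z zy].
    by rewrite indicE mem_set// mule1 adde0.
  by rewrite indicE memNset ?mule0// => yz; rewrite yz eqxx in zy.
rewrite ge0_integral_sum//; last first.
  by move=> z y _; rewrite mule_ge0// lee_fin.
apply: eq_bigr => z _; rewrite ge0_integralZl//.
by rewrite integral_indic ?setIT//; exact: measurable_tuple_bool.
Qed.

Lemma prob_tuple_boolE (P : probability (n.-tuple bool) R) A :
  P A = (\sum_(y : n.-tuple bool | y \in A) P [set y])%E.
Proof.
have mA := measurable_tuple_bool A.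
rewrite -[A in LHS]setIT -integral_indic// integral_tuple_bool;
  last by move=> y; rewrite lee_fin.
rewrite [RHS]big_mkcond/=; apply: eq_bigr => y _.
by rewrite indicE; case: ifP; rewrite ?mul1e ?mul0e.
Qed.

End tuple_bool.

Section likelihood.
Context {R : realType} {n d : nat}.
Local Open Scope classical_set_scope.
Implicit Types (theta : d.-tuple R) (x : n.-tuple (d.-tuple R)).
Implicit Types (y : n.-tuple bool).

Lemma likelihood_gt0 theta x y : 0 < likelihood theta x y.
Proof. by apply: prodr_gt0 => i _; exact: sigmoid_gt0. Qed.

Lemma likelihood_le1 theta x y : likelihood theta x y <= 1.
Proof.
by apply: numdomain.Num.Theory.prodr_ile1 => i _;
  rewrite !ltW ?sigmoid_gt0 ?sigmoid_lt1.
Qed.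

Lemma label_law_set1 theta x y :
  label_law theta x [set y] = (likelihood theta x y)%:E.
Proof.
rewrite (_ : [set y] = [set t | forall i, [set tnth y i] (tnth t i)]);
    last first.
  apply/seteqP; split => [t -> i//|t ty]; apply/eq_from_tnth => i; exact: ty.
rewrite /label_law (@prod_tuple_rect _ _ _ _ _ (fun i => [set tnth y i]))//.
rewrite /likelihood -prodEFin; apply: eq_bigr => i _.
rewrite sigmoid_label.
have p01 : 0 <= sigmoid (dot (tnth x i) theta) <= 1.
  by rewrite !ltW ?sigmoid_gt0 ?sigmoid_lt1.
rewrite [LHS](bernoulli_probE p01).
rewrite !diracE; case: (tnth y i).
  by rewrite mem_set// memNset// mule1 mule0 adde0.
by rewrite memNset// mem_set// mule1 mule0 add0e.
Qed.

Lemma label_lawE theta x (A : set (n.-tuple bool)) :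
  label_law theta x A =
  (\sum_(y : n.-tuple bool | y \in A) likelihood theta x y)%:E.
Proof.
rewrite prob_tuple_boolE -sumEFin; apply: eq_bigr => y _.
exact: label_law_set1.
Qed.

Definition max_likelihood x y : R :=
  sup (range (fun theta => likelihood theta x y)).

Lemma has_sup_likelihood x y :
  has_sup (range (fun theta : d.-tuple R => likelihood theta x y)).
Proof.
split; first by exists (likelihood [tuple of nseq d 0] x y); eexists.
by exists 1 => _ [theta _ <-]; exact: likelihood_le1.
Qed.

Lemma le_max_likelihood theta x y :
  likelihood theta x y <= max_likelihood x y.
Proof. by apply: (sup_upper_bound (has_sup_likelihood x y)); exists theta. Qed.

Lemma max_likelihood_gt0 x y : 0 < max_likelihood x y.
Proof.
by apply: lt_le_trans (le_max_likelihood [tuple of nseq d 0] x y);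
  exact: likelihood_gt0.
Qed.

(** For separable labels the supremum is only approached at infinity, so near maximizers replace
    maximum likelihood estimators. *)
Lemma max_likelihood_adherent x y e : 0 < e ->
  exists theta, max_likelihood x y < likelihood theta x y + e.
Proof.
move=> e0; have [_ [theta _ <-]] := sup_adherent e0 (has_sup_likelihood x y).
by rewrite ltrBlDr; exists theta.
Qed.

Lemma log_lr_ge0 theta x y : 0 <= log_lr theta x y.
Proof.
by rewrite ln_ge0// ler_pdivlMr ?likelihood_gt0// mul1r le_max_likelihood.
Qed.

Lemma expR_log_lr theta x y :
  expR (log_lr theta x y) * likelihood theta x y = max_likelihood x y.
Proof.
rewrite lnK ?posrE ?divr_gt0 ?max_likelihood_gt0 ?likelihood_gt0//.
by rewrite divfK// gt_eqF// likelihood_gt0.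
Qed.

Lemma sum_likelihood theta x : \sum_y likelihood theta x y = 1.
Proof.
apply/EFin_inj; rewrite -[RHS](@probability_setT _ _ _ (label_law theta x)).
by rewrite label_lawE; congr EFin; apply: eq_bigl => y; rewrite in_setT.
Qed.

End likelihood.

(** * The Shtarkov sum *)

Section uniform01.
Context {R : realType}.
Local Open Scope classical_set_scope.

Definition uniform01 : probability (measurableTypeR R) R :=
  uniform_prob (@ltr01 R).

Lemma uniform01_lt (a : R) : 0 <= a <= 1 ->
  uniform01 [set u | u < a] = a%:E.
Proof.
move=> /andP[a0 a1]; rewrite /uniform01/= /uniform_prob integral_uniform_pdf.
rewrite (_ : _ `&` _ = `[0, a[); last first.
  apply/seteqP; split => u /=; rewrite !in_itv/=.
    by move=> [-> /andP[->]].
  by move=> /andP[-> ua]; rewrite ua (le_trans (ltW ua)).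
under eq_integral.
  move=> u; rewrite inE/= in_itv/= => /andP[u0 ua].
  rewrite /uniform_pdf u0 (le_trans (ltW ua))//= subr0 invr1; over.
rewrite integral_cst//= mul1e lebesgue_measure_itv/= lte_fin.
by case: ltgtP a0 => // [_ _|<- _]; rewrite ?sube0.
Qed.

Lemma uniform01_ge (a : R) : 0 <= a <= 1 ->
  uniform01 (~` [set u | u < a]) = (1 - a)%:E.
Proof.
move=> a01; rewrite probability_setC; first by rewrite uniform01_lt.
rewrite (_ : mkset _ = `]-oo, a[); first exact: measurable_itv.
by apply/seteqP; split => u /=; rewrite in_itv.
Qed.

Lemma uniform01_set1 (c : R) : uniform01 [set c] = 0%E.
Proof.
have /null_content_dominatesP h := dominates_uniform_prob (@ltr01 R).
by apply: h => //; exact: lebesgue_measure_set1.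
Qed.

End uniform01.

Section shtarkov.
Context {R : realType} {n d : nat}.
Local Open Scope classical_set_scope.
Implicit Types (x : n.-tuple (d.-tuple R)) (y : n.-tuple bool).

(* A label is [true] with probability [sigmoid t] exactly when a uniform
   variable falls below [sigmoid t].  With the same uniform variables for all
   parameters, the sum becomes the expected number of patterns realized by a
   threshold class, which Sauer-Shelah controls. *)
Lemma sum_likelihood_le x (theta : n.-tuple bool -> d.-tuple R) :
  \sum_y likelihood (theta y) x y <= (\sum_(k < d.+1) 'C(n, k))%:R.
Proof.
pose P : probability (n.-tuple (measurableTypeR R)) R :=
  prod_tuple (fun=> uniform01).
(* [A y i] is the event that the uniform variable reproduces label [i] of [y] under [theta y]. By
   independence [E y] has the likelihood of [y] as probability. *)
pose A y (i : 'I_n) : set (measurableTypeR R) :=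
  if tnth y i then [set u | u < sigmoid (dot (tnth x i) (theta y))]
  else ~` [set u | u < sigmoid (dot (tnth x i) (theta y))].
have mA y i : measurable (A y i).
  have m : @measurable _ (measurableTypeR R)
      [set u | u < sigmoid (dot (tnth x i) (theta y))].
    rewrite (_ : mkset _ = `]-oo, sigmoid (dot (tnth x i) (theta y))[).
      exact: measurable_itv.
    by apply/seteqP; split => u /=; rewrite in_itv.
  by rewrite /A; case: ifP => // _; exact: measurableC.
pose E y := [set u : n.-tuple (measurableTypeR R) | forall i, A y i (tnth u i)].
have PE y : P (E y) = (likelihood (theta y) x y)%:E.
  rewrite [LHS](prod_tuple_rect (fun=> uniform01) (mA y)).
  rewrite /likelihood -prodEFin; apply: eq_bigr => i _.
  rewrite sigmoid_label /A; case: ifP => _.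
    by rewrite uniform01_lt// !ltW ?sigmoid_gt0 ?sigmoid_lt1.
  by rewrite uniform01_ge// !ltW ?sigmoid_gt0 ?sigmoid_lt1.
have mE y : measurable (E y) by exact: (measurable_tuple_rect (mA y)).
rewrite -lee_fin -sumEFin; under eq_bigr do rewrite -PE.
under eq_bigr => y _ do rewrite -(setIT (E y)) -integral_indic//.
rewrite -ge0_integral_sum//; last first.
  by move=> y; apply/measurable_EFinP; exact: measurable_indic.
rewrite -[leRHS]mule1 -(@probability_setT _ _ _ P) -integral_cst//.
apply: ge0_le_integral => //.
- by move=> u _; apply: sume_ge0 => y _; rewrite lee_fin.
- apply: emeasurable_sum => y; apply/measurable_EFinP.
  exact: measurable_indic.
move=> u _; rewrite sumEFin lee_fin /=.
(* At a fixed [u] the sum counts the [y] with [u] in [E y]. As sets of [true] indices, these form a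
   family of threshold patterns. *)
pose F := [set [set i | tnth y i]%SET | y : n.-tuple bool & u \in E y]%SET.
have cF : #|F| = #|[set y : n.-tuple bool | u \in E y]%SET|.
  apply: card_imset => y z /setP yz; apply/eq_from_tnth => i.
  by have := yz i; rewrite !inE.
rewrite (_ : \sum_y _ = #|F|%:R).
  have := @sauer_shelah _ F d; rewrite card_ord ler_nat; apply => S.
  pose X : 'M[R]_(n, d) := \matrix_(i, j) tnth (tnth x i) j.
  apply: (@card_threshold_shatters _ _ _ sigmoid X (tnth u)) =>
    [|B /imsetP[y + ->]].
    exact: sigmoid_homo.
  rewrite inE inE => yu; exists (\col_j tnth (theta y) j) => i.
  rewrite inE (_ : (X *m _) i ord0 = dot (tnth x i) (theta y)).
    have := yu i; rewrite /A; case: ifP => // _ /= /negP/negbTE ->; exact/esym.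
  by rewrite mxE; apply: eq_bigr => j _; rewrite !mxE.
rewrite cF -sum1_card natr_sum [RHS]big_mkcond/=; apply: eq_bigr => y _.
by rewrite indicE inE; case: (u \in E y).
Qed.

Lemma sum_max_likelihood_le x :
  \sum_y max_likelihood x y <= (\sum_(k < d.+1) 'C(n, k))%:R.
Proof.
apply/ler_addgt0Pr => e e0.
(* An error of [e / N] for each of the [N] label vectors adds up to [e]. *)
pose N : R := #|{: n.-tuple bool}|%:R.
have N0 : 0 < N.
  by rewrite ltr0n; apply/card_gt0P; exists [tuple of nseq n true].
have /choice[theta thetaP] :=
  fun y => max_likelihood_adherent x y (divr_gt0 e0 N0).
apply: le_trans (lerD (sum_likelihood_le x theta) (lexx e)).
have -> : e = \sum_(y : n.-tuple bool) (e / N).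
  by rewrite sumr_const -mulr_natr divfK ?gt_eqF.
by rewrite -big_split/=; apply: ler_sum => y _; exact: ltW.
Qed.

End shtarkov.

(** * Upper bounds *)

Section semidirect_integral.
Import HBNNSimple.
Local Open Scope ereal_scope.

(** The integral is a supremum over simple functions below the integrand, and those below [f] are
    below [g]. This serves integrands such as [log_lr], whose measurability in the design is not
    established here. *)
Lemma ge0_le_integral_nonmeasurable d (T : measurableType d) (R : realType)
    (mu : measure T R) (f g : T -> \bar R) :
  (forall t, 0 <= f t) -> (forall t, f t <= g t) ->
  \int[mu]_t f t <= \int[mu]_t g t.
Proof.
move=> f0 fg; have g0 t : 0 <= g t by exact: le_trans (fg t).
rewrite !ge0_integralTE//; apply: ereal_sup_le => _ [h hf <-].
by exists h => // t; exact: le_trans (fg t).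
Qed.

(** One half of Tonelli's theorem: for a simple function [h] below [f] the iterated integral is
    computed exactly, and its inner integral is at most that of [f], hence at most [M]. *)
Lemma integral_semidirect_le d1 d2 (X : measurableType d1)
    (Y : measurableType d2) (R : realType) (P : probability X R)
    (k : R.-pker X ~> Y) (f : X * Y -> \bar R) (M : R) :
  (forall z, 0 <= f z) -> (forall x, \int[k x]_y f (x, y) <= M%:E) ->
  \int[semidirect P k]_z f z <= M%:E.
Proof.
move=> f0 fM; rewrite ge0_integralTE//; apply: ge_ereal_sup => _ [h hf <-].
rewrite sintegralE.
have mh r : measurable (h @^-1` [set r]) by [].
have h0 r z : 0 <= (r * \1_(h @^-1` [set r]) z)%:E :> \bar R.
  rewrite indicE; case: ((_ : _ * _) \in _) / boolP => [|_];
    last by rewrite mulr0.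
  by rewrite inE/= => <-; rewrite mulr1 lee_fin.
pose G r x := r%:E * k x (xsection (h @^-1` [set r]) x).
have mG r : measurable_fun setT (G r).
  apply: measurable_funeM; apply: measurable_fun_xsection_finite_kernel.
  by rewrite inE.
have kE x r : G r x = \int[k x]_y (r * \1_(h @^-1` [set r]) (x, y))%:E.
  have mS : measurable (xsection (h @^-1` [set r]) x).
    exact: measurable_xsection.
  have -> : \int[k x]_y (r * \1_(h @^-1` [set r]) (x, y))%:E =
      \int[k x]_y (r%:E * (\1_(xsection (h @^-1` [set r]) x) y)%:E).
    apply: eq_integral => y _; rewrite EFinM; congr (_ * (_%:E)).
    by rewrite !indicE mem_xsection.
  have [r0|r0] := leP 0%R r.
    rewrite ge0_integralZl_EFin//; last first.
      by apply/measurable_EFinP; exact: measurable_indic.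
    by rewrite integral_indic// setIT.
  rewrite /G (_ : xsection _ _ = set0).
    by rewrite measure0 mule0 integral0_eq// => y _; rewrite indic0 mule0.
  apply/seteqP; split => // y; rewrite /xsection/= inE/= => hr.
  by have : (0 <= h (x, y))%R by []; rewrite hr leNgt r0.
have G0 r x : 0 <= G r x by rewrite kE; apply: integral_ge0 => y _.
have hsum (z : X * Y) :
    (h z)%:E = \sum_(r \in range h) (r * \1_(h @^-1` [set r]) z)%:E.
  by rewrite [in LHS](fimfunE h) -fsumEFin.
have fin_h : finite_set (range h) by exact: fimfunP.
have -> : \sum_(r \in range h) r%:E * semidirect P k (h @^-1` [set r]) =
    \int[P]_x \sum_(r \in range h) G r x.
  rewrite ge0_integral_fsum//; apply: eq_fsbigr => r /set_mem[z _ hz].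
  have r0 : (0 <= r)%R by rewrite -hz.
  rewrite /semidirect -ge0_integralZl_EFin//.
  by apply: measurable_fun_xsection_finite_kernel; rewrite inE.
apply: (@le_trans _ _ (\int[P]_x M%:E)); last first.
  by rewrite integral_cst// [X in _ * X]probability_setT mule1.
apply: ge0_le_integral_nonmeasurable => x.
  by apply: fsume_ge0 => r _.
apply: le_trans (fM x).
have -> : \sum_(r \in range h) G r x = \int[k x]_y (h (x, y))%:E.
  under [RHS]eq_integral do rewrite hsum.
  rewrite ge0_integral_fsum//.
    by apply: eq_fsbigr => r _; rewrite kE.
  move=> r; apply/measurable_EFinP; apply: measurable_funM => //.
  rewrite (_ : (fun y => _) = \1_(xsection (h @^-1` [set r]) x)).
    by apply: measurable_indic; exact: measurable_xsection.
  by apply/funext => y; rewrite !indicE mem_xsection.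
by apply: ge0_le_integral_nonmeasurable => y; rewrite ?lee_fin.
Qed.

End semidirect_integral.

Section upper_bounds.
Context {R : realType} {n d : nat}.
Local Open Scope classical_set_scope.
Implicit Types (theta : d.-tuple R) (x : n.-tuple (d.-tuple R)).
Implicit Types (y : n.-tuple bool) (P : probability (d.-tuple R) R).
Hypotheses (d0 : (0 < d)%N) (dn : (d <= n)%N).

Let r : R := d%:R * ln (expR 1 * n%:R / d%:R).

Lemma sum_expR_log_lr theta x :
  \sum_y expR (log_lr theta x y) * likelihood theta x y <= expR r.
Proof.
under eq_bigr do rewrite expR_log_lr.
exact: le_trans (sum_max_likelihood_le x) (sum_bin_le R d0 dn).
Qed.

Lemma log_lr_tail theta x delta : 0 < delta ->
  ((1 - delta)%:E <=
   label_law theta x [set y | (log_lr theta x y <= r + ln (1 / delta))%R])%E.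
Proof.
move=> delta0; rewrite label_lawE lee_fin.
set z := r + ln _; set A := [set y | _].
rewrite -(sum_likelihood theta x) (bigID (mem A))/=.
rewrite lerBlDr lerD2l.
(* Markov's inequality: off [A] the factor [exp (Lambda - z)] is at least 1, and [z] is such that
   [exp (r - z) = delta]. *)
apply: (@le_trans _ _
    (\sum_y expR (log_lr theta x y - z) * likelihood theta x y)).
  rewrite [leLHS]big_mkcond/=; apply: ler_sum => y _.
  have L0 := likelihood_gt0 theta x y.
  case: ifPn => [|_]; last by rewrite mulr_ge0// ltW// expR_gt0.
  rewrite notin_setE/= => /negP; rewrite -ltNge => zy.
  by rewrite -[leLHS]mul1r ler_wpM2r ?(ltW L0)// -expR0 ler_expR subr_ge0 ltW.
under eq_bigr do rewrite expRD mulrAC.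
rewrite -mulr_suml expRN ler_pdivrMr ?expR_gt0//.
apply: le_trans (sum_expR_log_lr theta x) _.
rewrite /z expRD lnK ?posrE ?divr_gt0// mulrCA mul1r.
by rewrite divff ?mulr1// gt_eqF.
Qed.

Lemma log_lr_mean theta x :
  (\int[label_law theta x]_y (log_lr theta x y)%:E <= r%:E)%E.
Proof.
rewrite integral_tuple_bool; last by move=> y; rewrite lee_fin log_lr_ge0.
under eq_bigr do rewrite label_law_set1 -EFinM.
rewrite sumEFin lee_fin.
(* Jensen's inequality in tangent form: [Lambda <= r - 1 + exp (Lambda - r)], where the last term
   has mean at most 1. *)
apply: (@le_trans _ _ (\sum_y ((r - 1) * likelihood theta x y +
    expR (- r) * (expR (log_lr theta x y) * likelihood theta x y)))).
  apply: ler_sum => y _; rewrite mulrA -mulrDl -expRD.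
  apply: ler_wpM2r; first by rewrite ltW// likelihood_gt0.
  by have := expR_ge1Dx (- r + log_lr theta x y); lra.
rewrite big_split/= -!mulr_sumr sum_likelihood mulr1.
suff : expR (- r) *
    (\sum_y expR (log_lr theta x y) * likelihood theta x y) <= 1.
  by lra.
by rewrite expRN mulrC ler_pdivrMr ?expR_gt0// mul1r sum_expR_log_lr.
Qed.

Lemma Q_FD_le delta : 0 < delta ->
  (@Q_FD R n d (1 - delta) <= (r + ln (1 / delta))%:E)%E.
Proof.
move=> delta0; apply: ge_ereal_sup => _ [x [theta ->]].
apply: ereal_inf_lbound; exists (r + ln (1 / delta)) => //.
exact: log_lr_tail.
Qed.

Lemma E_FD_le : (@E_FD R n d <= r%:E)%E.
Proof.
apply: ge_ereal_sup => _ [x [theta ->]].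
by rewrite unlock; exact: log_lr_mean.
Qed.

Lemma quantile_sample_law_le theta P q w : 0 <= q ->
  (forall x,
    (q%:E <= label_law theta x [set y | (log_lr theta x y <= w)%R])%E) ->
  (quantile (sample_law theta P) q
    (fun xy : n.-tuple _ * n.-tuple bool => log_lr theta xy.1 xy.2) <= w%:E)%E.
Proof.
move=> q0 qw; apply: ereal_inf_lbound; exists w => //=.
apply: (@le_trans _ _ (\int[prod_tuple (fun=> P) : probability _ _]_x q%:E)%E).
  by rewrite integral_cst// [X in (_ * X)%E]probability_setT mule1.
apply: ge0_le_integral_nonmeasurable => x; first by rewrite lee_fin.
rewrite (_ : xsection _ _ = [set y | log_lr theta x y <= w]).
  exact: qw.
by apply/seteqP; split => y; rewrite xsectionP.
Qed.

Lemma Q_RD_le delta : 0 < delta -> delta <= 1 ->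
  (@Q_RD R n d (1 - delta) <= (r + ln (1 / delta))%:E)%E.
Proof.
move=> delta0 delta1; apply: ge_ereal_sup => _ [theta [P ->]].
apply: quantile_sample_law_le => [|x]; first by lra.
exact: log_lr_tail.
Qed.

(** If all fixed-design quantiles were below [c - e], the conditional probability of
    [Lambda <= c - e] would be at least [q] for every design, hence also on average. The slack [e]
    makes this contradict [c <= Q_RD]. *)
Lemma Q_RD_le_Q_FD q c : 0 <= q ->
  (c%:E <= @Q_RD R n d q)%E -> (c%:E <= @Q_FD R n d q)%E.
Proof.
move=> q0 cRD; apply/lee_subgt0Pr => e e0; rewrite leNgt; apply/negP => FDc.
suff : (@Q_RD R n d q <= (c - e)%:E)%E.
  by move=> /(le_trans cRD); rewrite lee_fin; lra.
apply: ge_ereal_sup => _ [theta [P ->]].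
apply: quantile_sample_law_le => // x.
have : (quantile (label_law theta x) q (log_lr theta x) < (c - e)%:E)%E.
  by apply: le_lt_trans FDc; apply: ereal_sup_ubound; exists x, theta.
move=> /ereal_inf_lt[_ [z /= qz <-]]; rewrite lte_fin => zc.
apply: (le_trans qz); apply: le_measure; rewrite ?inE;
  [exact: measurable_tuple_bool..|].
by move=> y /= /le_trans; apply; exact: ltW.
Qed.

Lemma E_RD_le : (@E_RD R n d <= r%:E)%E.
Proof.
apply: ge_ereal_sup => _ [theta [P ->]].
rewrite unlock; apply: integral_semidirect_le => [z|x].
  by rewrite lee_fin log_lr_ge0.
exact: log_lr_mean.
Qed.

Lemma E_RD_le_E_FD c :
  (c%:E <= @E_RD R n d)%E -> (c%:E <= @E_FD R n d)%E.
Proof.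
move=> cRD; apply/lee_subgt0Pr => e e0; rewrite leNgt; apply/negP => FDc.
suff : (@E_RD R n d <= (c - e)%:E)%E.
  by move=> /(le_trans cRD); rewrite lee_fin; lra.
apply: ge_ereal_sup => _ [theta [P ->]].
rewrite unlock; apply: integral_semidirect_le => [z|x].
  by rewrite lee_fin log_lr_ge0.
apply: ltW; apply: le_lt_trans FDc; apply: ereal_sup_ubound.
by exists x, theta; rewrite unlock.
Qed.

End upper_bounds.

(** * Random points on the moment curve *)

Section distinct_samples.
Context {dT} {T : measurableType dT} {R : realType}.
Variables (P : probability T R) (f : T -> R).
Hypotheses (mf : measurable_fun setT f).
Local Open Scope classical_set_scope.
Hypothesis f_atomless : forall c, P (f @^-1` [set c]) = 0%E.

Definition distinct_values n := [set x : n.-tuple T | uniq (map f x)].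

Lemma distinct_valuesP n (x : n.-tuple T) :
  distinct_values x <-> injective (fun i => f (tnth x i)).
Proof.
rewrite /distinct_values/=; split.
  move=> /(@tuple_uniqP _ _ (map_tuple f x)) h i j.
  by move=> fij; apply: h; rewrite !tnth_map.
move=> h; apply/(@tuple_uniqP _ _ (map_tuple f x)) => i j.
by rewrite !tnth_map => /h.
Qed.

Lemma measurable_distinct_values n : measurable (@distinct_values n).
Proof.
rewrite (_ : @distinct_values n = \bigcap_(ij in [set: 'I_n * 'I_n])
    [set x | f (tnth x ij.1) == f (tnth x ij.2) -> ij.1 = ij.2]); last first.
  apply/seteqP; split => x.
    by move=> /distinct_valuesP h [i j] _ /= /eqP /h.
  by move=> h; apply/distinct_valuesP => i j /eqP; exact: (h (i, j)).
apply: fin_bigcap_measurable => // -[i j] _ /=.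
have [->|ij] := eqVneq i j; first
  by rewrite (_ : mkset _ = setT)//; apply/seteqP.
rewrite (_ : mkset _ =
    ~` ((fun x : n.-tuple T => f (tnth x i) == f (tnth x j)) @^-1` [set true])).
  apply: measurableC; rewrite -[X in measurable X]setTI.
  apply: measurable_fun_eqr => //.
    exact: (measurableT_comp mf (measurable_tnth i)).
  exact: (measurableT_comp mf (measurable_tnth j)).
apply/seteqP; split => x /=; first by move=> h /h /eqP; rewrite (negbTE ij).
by move=> h /h.
Qed.

Let measurable_preimage_seq (s : seq R) : measurable [set z | f z \in s].
Proof.
elim: s => [|c s IH].
  by rewrite (_ : mkset _ = set0); [exact: measurable0|apply/seteqP; split].
rewrite (_ : mkset _ = (f @^-1` [set c] `|` [set z | f z \in s])).
  by apply: measurableU => //; rewrite -[X in measurable X]setTI; apply: mf.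
apply/seteqP; split => z /=; rewrite inE.
  by move=> /orP[/eqP|]; [left|right].
by case=> [->|->]; rewrite ?eqxx ?orbT.
Qed.

Lemma preimage_seq_measure0 (s : seq R) : P [set z | f z \in s] = 0%E.
Proof.
apply/(negligibleP _ (measurable_preimage_seq s)).
elim: s => [|c s IH].
  by rewrite (_ : mkset _ = set0); [exact: negligible_set0|apply/seteqP; split].
apply: (@negligibleS _ _ _ _ (f @^-1` [set c] `|` [set z | f z \in s])).
  by move=> z /=; rewrite inE => /orP[/eqP|]; [left|right].
apply: negligibleU => //.
have mc : measurable (f @^-1` [set c]).
  by rewrite -[X in measurable X]setTI; apply: mf.
by apply/(negligibleP _ mc); exact: f_atomless.
Qed.

(** Given the tail of the sample, the new point has to avoid finitely many values of [f], each of
    probability zero. *)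
Lemma prod_tuple_distinct_values n :
  prod_tuple (fun _ : 'I_n => P) (@distinct_values n) = 1%E.
Proof.
elim: n => [|n IH] /=.
  by rewrite diracE mem_set//= /distinct_values/= tuple0.
rewrite /distribution/= /pushforward /prod_prob.
set Q := prod_tuple _ in IH *; set B := _ @^-1` _.
have mB : measurable B.
  rewrite -[B]setTI; apply: (measurable_funPT (@tcons _ T n)) => //.
  exact: measurable_distinct_values.
(* The order of integration is exchanged, so that the tail is fixed first and [P] measures the
   admissible new points. *)
have -> : (P \x Q)%E B = (P \x^ Q)%E B.
  by apply: product_measure_unique => // *; exact: product_measure2E.
rewrite /product_measure2.
transitivity (\int[Q]_t (\1_(@distinct_values n) t)%:E)%E; last first.
  by rewrite integral_indic ?setIT//; exact: measurable_distinct_values.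
apply: eq_integral => t _ /=; rewrite indicE.
have [tD|tD] := boolP (t \in @distinct_values n).
  rewrite (_ : ysection B t = ~` [set z | f z \in map f t]).
    by rewrite probability_setC ?preimage_seq_measure0 ?sube0.
  move: tD; rewrite inE /distinct_values/= => tD.
  by apply/seteqP; split => z;
    rewrite /ysection /B /distinct_values/= inE/= tD andbT => /negP.
rewrite (_ : ysection B t = set0) ?measure0//.
apply/seteqP; split => // z; rewrite /ysection /B /distinct_values/= inE/=.
by move=> /andP[_ h]; move: tD; rewrite notin_setE; apply.
Qed.

End distinct_samples.

Lemma probability_setI1 d (T : measurableType d) (R : realType)
    (P : probability T R) (A B : set T) : measurable A -> measurable B ->
  P A = 1%E -> P B = 1%E -> P (A `&` B)%classic = 1%E.
Proof.
move=> mA mB PA PB.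
have mAB : measurable (~` A `|` ~` B)%classic.
  by apply: measurableU; exact: measurableC.
rewrite -[X in P X]setCK setCI probability_setC//.
suff -> : P (~` A `|` ~` B)%classic = 0%E by rewrite sube0.
have P0 C : measurable C -> P C = 1%E -> P (~` C)%classic = 0%E.
  by move=> mC PC; rewrite probability_setC// PC subee.
by rewrite measureU0;
  [exact: P0|exact: measurableC|exact: measurableC|exact: P0].
Qed.

Section moment_curve.
Context {R : realType} {d : nat}.
Hypothesis d1 : (1 < d)%N.
Local Open Scope classical_set_scope.

(* [uniform01] lives on [measurableTypeR R], which has the same measurable sets
   as [R] but a different display. *)
Definition moment (t : measurableTypeR R) : d.-tuple R :=
  [tuple t ^+ i | i < d].

Let measurable_moment : measurable_fun setT moment.
Proof.
apply/measurable_fun_tnthP => i.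
rewrite (_ : _ \o _ = fun t => t ^+ i); first exact: exprn_measurable.
by apply/funext => t /=; rewrite tnth_mktuple.
Qed.

HB.instance Definition _ :=
  isMeasurableFun.Build _ _ _ _ moment measurable_moment.

Definition moment_law : probability (d.-tuple R) R :=
  distribution uniform01 moment.

Let one : 'I_d := Ordinal d1.

Lemma tnth_moment1 t : tnth (moment t) one = t.
Proof. by rewrite tnth_mktuple expr1. Qed.

(** The coordinate of index 1 is the parameter itself, so the curve is cut out by polynomial
    equations, which makes it measurable. *)
Definition moment_curve := [set v : d.-tuple R | v = moment (tnth v one)].

Lemma measurable_moment_curve : measurable (moment_curve : set (d.-tuple R)).
Proof.
rewrite (_ : moment_curve = \bigcap_(i in [set: 'I_d])
    ((fun v : d.-tuple R => tnth v i == tnth v one ^+ i) @^-1` [set true]));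
    last first.
  apply/seteqP; split => v.
    move=> vE i _; have := congr1 (fun w => tnth w i) vE.
    by rewrite tnth_mktuple /= => /eqP.
  move=> h; apply/eq_from_tnth => i; rewrite tnth_mktuple.
  by apply/eqP; exact: (h i).
apply: fin_bigcap_measurable => // i _; rewrite -[X in measurable X]setTI.
apply: measurable_fun_eqr => //; first exact: measurable_tnth.
by apply: measurable_funX; exact: measurable_tnth.
Qed.

Definition moment_samples n : set (n.-tuple (d.-tuple R)) :=
  [set x | forall i, moment_curve (tnth x i)] `&`
  distinct_values (fun v : d.-tuple R => tnth v one) (n:=n).

Lemma moment_samplesP n (x : n.-tuple (d.-tuple R)) : moment_samples x ->
  exists2 t : 'I_n -> R, injective t & forall i, tnth x i = moment (t i).
Proof.
move=> [xC /distinct_valuesP inj].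
by exists (fun i => tnth (tnth x i) one) => // i; exact: xC.
Qed.

Lemma measurable_moment_samples n :
  measurable (@moment_samples n : set (n.-tuple (d.-tuple R))).
Proof.
apply: measurableI.
  exact: (measurable_tuple_rect (fun=> measurable_moment_curve)).
by apply: measurable_distinct_values; exact: measurable_tnth.
Qed.

Lemma prod_tuple_moment_samples n :
  prod_tuple (fun _ : 'I_n => moment_law) (@moment_samples n) = 1%E.
Proof.
have mcurve := measurable_moment_curve.
have mone : measurable_fun setT (fun v : d.-tuple R => tnth v one).
  exact: measurable_tnth.
apply: probability_setI1.
- exact: (measurable_tuple_rect (fun=> mcurve)).
- exact: measurable_distinct_values.
- rewrite [LHS](prod_tuple_rect _ (fun _ => mcurve)) big1// => i _.
  rewrite /moment_law /= /distribution /pushforward.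
  rewrite (_ : _ @^-1` _ = setT) ?probability_setT//.
  by apply/seteqP; split => // t _; rewrite /moment_curve/= tnth_moment1.
- apply: prod_tuple_distinct_values => // c.
  rewrite /moment_law /= /distribution /pushforward.
  rewrite (_ : _ @^-1` _ = [set c]); first exact: uniform01_set1.
  by apply/seteqP; split => t /=; rewrite tnth_moment1.
Qed.

End moment_curve.

(** * Separation and random design *)

Section random_design_lower_bound.
Context {R : realType} {n d : nat}.
Local Open Scope classical_set_scope.
Variables (theta : d.-tuple R) (P : probability (d.-tuple R) R).
Variables (G : set (n.-tuple (d.-tuple R))) (B : {set n.-tuple bool}) (b z : R).
Hypothesis mG : measurable G.
Hypothesis PG : prod_tuple (fun _ : 'I_n => P) G = 1%E.
Hypothesis GB : forall x, G x -> \sum_(y in B) likelihood theta x y = b.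
Hypothesis Gz : forall x y, G x -> y \in B -> z <= log_lr theta x y.

Let GxB : set (n.-tuple (d.-tuple R) * n.-tuple bool) := G `*` [set` B].

Let measurable_GxB : measurable GxB.
Proof. by apply: measurableX => //; exact: measurable_tuple_bool. Qed.

Let sample_law_GxB : sample_law theta P GxB = b%:E.
Proof.
rewrite /sample_law/= /semidirect.
transitivity (\int[prod_tuple (fun _ : 'I_n => P) : probability _ _]_x
    (b%:E * (\1_G x)%:E))%E.
  apply: eq_integral => x _ /=; rewrite indicE.
  have [xG|xG] := boolP (x \in G).
    rewrite mule1 (_ : xsection _ _ = [set` B]).
      rewrite label_lawE -(GB (set_mem xG)); congr EFin.
      by apply: eq_bigl => y; apply/idP/idP; rewrite inE.
    move: xG; rewrite inE => xG; apply/seteqP; split => y; rewrite xsectionP.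
      by case.
    by split.
  rewrite mule0 (_ : xsection _ _ = set0) ?measure0//.
  apply/seteqP; split => // y; rewrite xsectionP => -[/= xG' _].
  by move: xG; rewrite notin_setE.
have /set0P[x xG] : G != set0.
  apply/eqP => G0; move: PG; rewrite G0 measure0 => /eqP.
  by rewrite eqe eq_sym oner_eq0.
have b0 : 0 <= b.
  by rewrite -(GB xG) sumr_ge0// => y _; rewrite ltW// likelihood_gt0.
rewrite ge0_integralZl_EFin//; last first.
  by apply/measurable_EFinP; exact: measurable_indic.
by rewrite integral_indic// setIT [X in (_ * X)%E]PG mule1.
Qed.

(** For [w < z] the event [Lambda <= w] misses [GxB], so its probability is at most
    [1 - b < 1 - delta] and [w] cannot enter the infimum. *)
Lemma le_Q_RD delta : delta < b -> (z%:E <= @Q_RD R n d (1 - delta))%E.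
Proof.
move=> db; apply: le_ereal_sup_tmp; eexists; first by exists theta, P.
apply: le_ereal_inf_tmp => _ [w /= qw <-]; rewrite lee_fin leNgt.
apply/negP => wz; move: qw; apply/negP; rewrite -ltNge.
apply: (@le_lt_trans _ _ (sample_law theta P (~` GxB))); last first.
  by rewrite probability_setC// sample_law_GxB -EFinB lte_fin; lra.
apply: ge0_le_integral_nonmeasurable => x //.
apply: le_measure; rewrite ?inE; [exact: measurable_tuple_bool..|].
move=> y; rewrite !xsectionP => /= yw -[/= xG yB].
by have := le_lt_trans yw wz; rewrite ltNge Gz.
Qed.

Lemma le_E_RD : 0 <= z -> ((z * b)%:E <= @E_RD R n d)%E.
Proof.
move=> z0; apply: le_ereal_sup_tmp; eexists; first by exists theta, P.
rewrite unlock EFinM -sample_law_GxB -[X in sample_law _ _ X]setIT.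
rewrite -integral_indic// -ge0_integralZl_EFin//; last first.
  by apply/measurable_EFinP; exact: measurable_indic.
apply: ge0_le_integral_nonmeasurable => -[x y].
  by rewrite mule_ge0// lee_fin.
rewrite -EFinM lee_fin indicE; case: (_ \in _) / boolP => [|_].
  by rewrite inE => -[/= xG yB]; rewrite mulr1 Gz.
by rewrite mulr0 log_lr_ge0.
Qed.

End random_design_lower_bound.

Section separation.
Context {R : realType} {n d : nat}.
Implicit Types (theta : d.-tuple R) (x : n.-tuple (d.-tuple R)).
Implicit Types (y : n.-tuple bool).

(* Scaling a separating parameter to infinity drives the likelihood to 1. *)
Lemma le1_max_likelihood theta x y :
  (forall i, 0 < label (tnth y i) * dot (tnth x i) theta) ->
  1 <= max_likelihood x y.
Proof.
move=> sep; pose m i := label (tnth y i) * dot (tnth x i) theta.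
pose thetas (s : R) : d.-tuple R := [tuple s * tnth theta j | j < d].
have dotZ s i : label (tnth y i) * dot (tnth x i) (thetas s) = s * m i.
  rewrite /m mulrCA; congr (_ * _); rewrite /dot mulr_sumr.
  by apply: eq_bigr => j _; rewrite tnth_mktuple mulrCA.
(* This follows from [1 - sigmoid u = 1 / (1 + exp u)] and [exp u >= 1 + u]. *)
have sigmoid_ge (u : R) : 0 < u -> 1 - u^-1 <= sigmoid u.
  move=> u0; rewrite -[u in sigmoid u]opprK sigmoidN lerD2l lerN2.
  rewrite sigmoidE opprK.
  rewrite lef_pV2 ?posrE ?addr_gt0 ?expR_gt0//.
  by have := expR_ge1Dx u; lra.
pose M := \sum_i (m i)^-1.
have M0 : 0 <= M by apply: sumr_ge0 => i _; rewrite invr_ge0 ltW ?sep.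
(* With this scale the defects [1 / (s * m i)] sum to [e * M / (M + 1) <= e]. *)
apply/ler_addgt0Pr => e e0; pose s := (M + 1) / e.
have s0 : 0 < s by rewrite divr_gt0//; lra.
apply: le_trans (lerD (le_max_likelihood (thetas s) x y) (lexx e)).
rewrite -lerBlDr; apply: (@le_trans _ _ (1 - \sum_i (s * m i)^-1)).
  rewrite lerD2l lerN2; under eq_bigr do rewrite invfM.
  rewrite -mulr_sumr -/M mulrC /s invf_div mulrA ler_pdivrMr; last lra.
  by rewrite mulrC ler_wpM2l ?(ltW e0)//; lra.
rewrite /likelihood; under [leRHS]eq_bigr do rewrite dotZ.
(* A product of numbers in [[0, 1]] is at least 1 minus the sum of their defects. Nonnegativity of
   the sum is carried along for the induction. *)
suff [] : 1 - \sum_i (s * m i)^-1 <= \prod_i sigmoid (s * m i) /\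
    0 <= \sum_i (s * m i)^-1 by [].
elim/big_rec2: _ => [|i S p _ [Sp S0]]; first by rewrite subr0.
have sm : 0 < s * m i by rewrite mulr_gt0// sep.
have smV : 0 < (s * m i)^-1 by rewrite invr_gt0.
have := sigmoid_ge _ sm; have := sigmoid_gt0 (s * m i).
have := sigmoid_lt1 (s * m i).
by move: (sigmoid _) ((s * m i)^-1) smV => u v; split; [nra|lra].
Qed.

Lemma log_lr_separable theta theta' x y :
  (forall i, 0 < label (tnth y i) * dot (tnth x i) theta') ->
  - ln (likelihood theta x y) <= log_lr theta x y.
Proof.
move=> /le1_max_likelihood L1; rewrite -lnV ?posrE ?likelihood_gt0//.
rewrite ler_ln ?posrE ?invr_gt0 ?divr_gt0 ?max_likelihood_gt0 ?likelihood_gt0//.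
by rewrite ler_peMl// invr_ge0 ltW// likelihood_gt0.
Qed.

(* The polynomial [\prod_j ('X - t_j)^2 - e], over the points [t_j] labelled
   [false], separates the labels. *)
Lemma moment_separable (t : 'I_n -> R) x y : injective t ->
  (forall i, tnth x i = moment (t i)) ->
  (#|[set i | ~~ tnth y i]|.*2 < d)%N ->
  exists theta, forall i, 0 < label (tnth y i) * dot (tnth x i) theta.
Proof.
move=> tinj xt Nd; set N := [set i | _] in Nd.
pose p : {poly R} := \prod_(i in N) ('X - (t i)%:P).
have pt0 i : tnth y i -> 0 < p.[t i] ^+ 2.
  move=> yi; rewrite exprn_even_gt0//= horner_prod prodf_seq_neq0.
  apply/allP => j _; apply/implyP; rewrite inE => yj.
  rewrite hornerXsubC subr_eq0; apply: contraNneq yj => /tinj <-.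
  by rewrite yi.
(* The inverse of [e] exceeds every [1 / p(t_i) ^ 2], so [e] lies strictly below [p ^ 2] at all
   points labelled [true]. *)
pose e : R := (1 + \sum_(i | tnth y i) (p.[t i] ^+ 2)^-1)^-1.
have S0 : 0 <= \sum_(i | tnth y i) (p.[t i] ^+ 2)^-1.
  by apply: sumr_ge0 => i yi; rewrite invr_ge0 ltW// pt0.
have e0 : 0 < e by rewrite invr_gt0; lra.
have ept i : tnth y i -> e < p.[t i] ^+ 2.
  move=> yi; rewrite -[X in _ < X]invrK ltf_pV2 ?posrE ?invr_gt0 ?pt0//;
    last lra.
  rewrite (bigD1 i)//=; set S := \sum_(_ | _) _.
  have : 0 <= S by apply: sumr_ge0 => j /andP[yj _]; rewrite invr_ge0 ltW// pt0.
  lra.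
pose q := p ^+ 2 - e%:P.
(* The degree of [q] is at most twice the number of [false] labels, hence less than [d]: its
   coefficients fit into a parameter. *)
have sq : (size q <= d)%N.
  apply: (leq_trans (size_polyD _ _)); rewrite geq_max size_polyN.
  rewrite (leq_trans (size_polyC_leq1 _)) ?(leq_ltn_trans _ Nd)// andbT.
  apply: (leq_trans (size_poly_exp_leq _ _)).
  by rewrite /p -big_enum size_prod_XsubC /= -cardE muln2.
exists [tuple q`_j | j < d] => i.
rewrite xt (_ : dot _ _ = q.[t i]); last first.
  rewrite (horner_coef_wide _ sq); apply: eq_bigr => j _.
  by rewrite !tnth_mktuple mulrC.
rewrite /q !hornerE /label; case: ifPn => yi.
  by rewrite mul1r subr_gt0 ept.
rewrite (_ : p.[t i] = 0) ?expr0n ?sub0r ?mulrNN ?mul1r//.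
by rewrite horner_prod (bigD1 i) ?inE//= hornerXsubC subrr mul0r.
Qed.

End separation.

(** * Rare labels *)

Lemma sum_tuple_prod (R : comRingType) (n : nat) (w : 'I_n -> bool -> R) :
  \sum_(y : n.-tuple bool) \prod_i w i (tnth y i) =
  \prod_i (w i true + w i false).
Proof.
transitivity (\prod_i \sum_b w i b); last first.
  by apply: eq_bigr => i _; rewrite big_bool.
rewrite bigA_distr_bigA.
rewrite (reindex (fun f : {ffun 'I_n -> bool} => [tuple f i | i < n]))/=.
  by apply: eq_bigr => f _; apply: eq_bigr => i _; rewrite tnth_mktuple.
exists (fun y => [ffun i => tnth y i]) => [f _|y _].
  by apply/ffunP => i; rewrite ffunE tnth_mktuple.
by apply/eq_from_tnth => i; rewrite tnth_mktuple ffunE.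
Qed.

Lemma expR1_ge2 {R : realType} : 2 < expR 1 :> R.
Proof. by rewrite -[ltLHS]/(1 + 1) expR_gt1Dx// oner_eq0. Qed.

Lemma expR1_le4 {R : realType} : expR 1 <= 4 :> R.
Proof.
have h : expR (2^-1) <= 2 :> R.
  have := expR_ge1Dx (- 2^-1 : R); rewrite expRN => h.
  rewrite -[leLHS]invrK -[leRHS]invrK lef_pV2 ?posrE ?invr_gt0 ?expR_gt0//.
  by lra.
rewrite (_ : 1 = 2^-1 + 2^-1 :> R) ?expRD; last by field.
have := expR_ge0 (2^-1 : R); nra.
Qed.

Section bernoulli_labels.
Context {R : realType} {n : nat}.
Implicit Types (y : n.-tuple bool) (p c : R).

Definition nfalse y := #|[set i | ~~ tnth y i]|.

(** Here [p] is the probability of [false], the rare label, so [nfalse] is binomial under these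
    weights. *)
Definition label_weight p y : R := \prod_i (if tnth y i then 1 - p else p).

Lemma expr_nfalse c y : c ^+ nfalse y = \prod_i (if tnth y i then 1 else c).
Proof.
rewrite /nfalse -prodr_const big_mkcond/=; apply: eq_bigr => i _.
by rewrite inE; case: (tnth y i).
Qed.

Lemma label_weight_gt0 p y : 0 < p < 1 -> 0 < label_weight p y.
Proof.
by move=> /andP[p0 p1]; apply: prodr_gt0 => i _; case: ifP; rewrite ?subr_gt0.
Qed.

Lemma label_weight_le p y : 0 < p < 1 -> label_weight p y <= p ^+ nfalse y.
Proof.
move=> /andP[p0 p1]; rewrite expr_nfalse; apply: ler_prod => i _.
by case: ifP => _; lra.
Qed.

Lemma label_weight_mgf p c :
  \sum_y label_weight p y * c ^+ nfalse y = (1 - p + p * c) ^+ n.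
Proof.
under eq_bigr do rewrite expr_nfalse -big_split/=.
pose w (i : 'I_n) (b : bool) := if b then 1 - p else p * c.
transitivity (\sum_(y : n.-tuple bool) \prod_i w i (tnth y i)).
  apply: eq_bigr => y _; apply: eq_bigr => i _.
  by rewrite /w; case: ifP; rewrite ?mulr1.
by rewrite sum_tuple_prod /w prodr_const card_ord.
Qed.

Lemma sum_label_weight p : \sum_y label_weight p y = 1.
Proof.
have := label_weight_mgf p 1; rewrite mulr1 subrK expr1n => <-.
by apply: eq_bigr => y _; rewrite expr1n mulr1.
Qed.

(** Markov's inequality for [c ^ nfalse], whose mean [(1 - p + p c) ^ n] is at most
    [exp (p (c - 1) n)]. Taking [c < 1] handles the lower tail and [c > 1] the upper one. *)
Lemma label_weight_chernoff p c (Q : pred (n.-tuple bool)) (b : R) :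
    0 < p < 1 -> 0 < c -> 0 < b -> (forall y, Q y -> b <= c ^+ nfalse y) ->
  \sum_(y | Q y) label_weight p y <= b^-1 * expR (p * (c - 1) * n%:R).
Proof.
move=> p01 c0 b0 Qb; have /andP[p0 p1] := p01.
apply: (@le_trans _ _ (b^-1 * \sum_y label_weight p y * c ^+ nfalse y)).
  rewrite mulr_sumr big_mkcond/=; apply: ler_sum => y _.
  have w0 := label_weight_gt0 y p01.
  case: ifPn => [/Qb bc|_]; last first.
    by rewrite !mulr_ge0 ?invr_ge0 ?exprn_ge0 ?(ltW w0) ?ltW.
  rewrite mulrC -mulrA -[leLHS]mulr1 ler_wpM2l ?(ltW w0)//.
  by rewrite ler_pdivlMr// mul1r.
rewrite label_weight_mgf ler_wpM2l ?invr_ge0 ?(ltW b0)// expRM_natr.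
have pc : 0 <= 1 - p + p * c by have := mulr_gt0 p0 c0; lra.
rewrite lerXn2r ?nnegrE ?expR_ge0//.
by have := expR_ge1Dx (p * (c - 1)); lra.
Qed.

End bernoulli_labels.

Section rare_labels.
Context {R : realType} (n d : nat).
Hypotheses (d3 : (3 <= d)%N) (dn : (d <= n)%N).

Let r : R := d%:R * ln (expR 1 * n%:R / d%:R).

Let n3 : 3 <= n%:R :> R.
Proof. by rewrite (ler_nat R 3) (leq_trans d3). Qed.

Let d0 : 0 < d%:R :> R.
Proof. by rewrite ltr0n (leq_trans _ d3). Qed.

(* One label is [false], each with probability [1 / n].  The probability
   [(1 - 1 / n) ^ (n - 1)] of this event exceeds [1 / e] but tends to it. *)
Lemma rare_labels_small : (d <= 64)%N ->
  exists (p : R) (B : {set n.-tuple bool}), [/\ 0 < p < 1,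
    forall y, y \in B -> ((nfalse y).*2 < d)%N,
    forall y, y \in B -> r / 128 <= (nfalse y)%:R * ln p^-1 &
    (expR 1)^-1 < \sum_(y in B) label_weight p y].
Proof.
move=> d64; have n3' := n3; have d0' := d0; pose p : R := n%:R^-1.
have p0 : 0 < p by rewrite /p invr_gt0; lra.
have p1 : p < 1 by rewrite /p invf_lt1; lra.
pose single (i : 'I_n) : n.-tuple bool := [tuple j != i | j < n].
have single_inj : injective single.
  move=> i j /(congr1 (fun y => tnth y i)); rewrite !tnth_mktuple eqxx.
  by move=> /esym/negbFE/eqP.
have nfalse_single i : nfalse (single i) = 1%N.
  rewrite /nfalse (_ : [set _ | _] = [set i]%SET) ?cards1//.
  by apply/setP => j; rewrite !inE tnth_mktuple negbK.
exists p, [set single i | i : 'I_n]%SET; split.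
- by rewrite p0.
- by move=> _ /imsetP[i _ ->]; rewrite nfalse_single (leq_trans _ d3).
- move=> _ /imsetP[i _ ->]; rewrite nfalse_single mul1r /p invrK.
  have lnn : 0 <= ln n%:R :> R by rewrite ln_ge0//; lra.
  (* Since [e n / d <= n ^ 2] and [d <= 64], [r] is at most [128 ln n], which fixes the constant
     128. *)
  have : ln (expR 1 * n%:R / d%:R) <= 2 * ln n%:R :> R.
    rewrite mulr_natl -lnXn; last by lra.
    rewrite ler_ln ?posrE ?divr_gt0 ?mulr_gt0 ?expR_gt0 ?exprn_gt0//; try lra.
    rewrite ler_pdivrMr//.
    have e4 := @expR1_le4 R; have dd : 3 <= d%:R :> R by rewrite (ler_nat R 3).
    have := expR_ge0 (1 : R); nra.
  have d64R : d%:R <= 64 :> R by rewrite (ler_nat R d 64).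
  rewrite ler_pdivrMr// /r; move: (ln _) (ln n%:R) lnn => u v v0 uv.
  nra.
rewrite big_imset/=; last by move=> i j _ _ /single_inj.
have wE i : label_weight p (single i) = p * (1 - p) ^+ n.-1.
  rewrite /label_weight (bigD1 i)//= tnth_mktuple eqxx; congr (_ * _).
  transitivity (\prod_(j : 'I_n | j != i) (1 - p)).
    by apply: eq_bigr => j ji; rewrite tnth_mktuple ji.
  rewrite prodr_const (_ : #|_| = n.-1)// -[in RHS](card_ord n).
  by rewrite -(cardC1 i).
under eq_bigr do rewrite wE.
rewrite sumr_const card_ord -[ltRHS]mulr_natl mulrA /p divff ?mul1r; last lra.
have n1 : (0 < n.-1)%N.
  by rewrite -subn1 subn_gt0 (leq_trans _ (leq_trans d3 dn)).
have nE : n%:R = n.-1%:R + 1 :> R.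
  by rewrite natr1 prednK// (leq_trans _ (leq_trans d3 dn)).
have n1R : 0 < n.-1%:R :> R by rewrite ltr0n.
rewrite -[ltRHS]invrK ltf_pV2 ?posrE ?expR_gt0 ?invr_gt0 ?exprn_gt0//;
    last first.
  by rewrite subr_gt0.
rewrite -exprVn (_ : (1 - p)^-1 = 1 + n.-1%:R^-1); last first.
  by rewrite /p nE; field; do ?[apply/andP; split]; rewrite gt_eqF//; lra.
(* Strictness comes from [1 + 1 / (n - 1) < exp (1 / (n - 1))], raised to the power [n - 1]. It is
   what allows [delta = 1 / e] later. *)
rewrite -[X in _ < expR X](@divff _ (n.-1%:R)) ?gt_eqF// mulrC expRM_natr.
rewrite ltr_pXn2r ?nnegrE ?expR_ge0 ?addr_ge0 ?invr_ge0 ?(ltW n1R)//.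
by rewrite expR_gt1Dx// invr_eq0 gt_eqF.
Qed.

(* With [m] about [d / 64], each label is [false] with probability [8 m / n];
   Chernoff bounds put the number of [false] labels between [2 m] and [32 m]. *)
Lemma rare_labels_large : (64 < d)%N ->
  exists (p : R) (B : {set n.-tuple bool}), [/\ 0 < p < 1,
    forall y, y \in B -> ((nfalse y).*2 < d)%N,
    forall y, y \in B -> r / 128 <= (nfalse y)%:R * ln p^-1 &
    (expR 1)^-1 < \sum_(y in B) label_weight p y].
Proof.
(* The predecessor of [d] is divided to get [64 m < d] strictly, so that [32 m] labels can still be
   separated, while [d <= 128 m]. *)
move=> d64; have n3' := n3; have d0' := d0; pose m := ((d.-1) %/ 64)%N.
have m1 : (0 < m)%N by rewrite divn_gt0// -ltnS prednK// (leq_trans _ d64).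
have md : (64 * m < d)%N.
  by rewrite mulnC -[ltnRHS](prednK (leq_trans _ d3))// ltnS leq_divM.
have dm : (d <= 128 * m)%N.
  have := ltn_ceil d.-1 (isT : (0 < 64)%N); rewrite -/m => h.
  have : (d <= m.+1 * 64)%N.
    by rewrite -[d in (d <= _)%N](prednK (leq_trans _ d3)).
  by move=> /leq_trans; apply; rewrite mulSn; lia.
have mR : 1 <= m%:R :> R by rewrite (ler_nat R 1).
have mR0 : 0 < m%:R :> R by lra.
have mdR : 64 * m%:R < d%:R :> R by rewrite -(natrM R 64) ltr_nat.
have dmR : d%:R <= 128 * m%:R :> R by rewrite -(natrM R 128) ler_nat.
have dnR : d%:R <= n%:R :> R by rewrite ler_nat.
pose p : R := 8 * m%:R / n%:R.
have n0 : 0 < n%:R :> R by lra.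
have p0 : 0 < p by rewrite divr_gt0//; lra.
have p1 : p < 1 by rewrite ltr_pdivrMr//; lra.
have p01 : 0 < p < 1 by rewrite p0.
have pn : p * n%:R = 8 * m%:R by rewrite divfK ?gt_eqF.
pose B := [set y : n.-tuple bool | (2 * m <= nfalse y <= 32 * m)%N]%SET.
exists p, B; split => //.
- by move=> y; rewrite inE => /andP[_ yN]; apply: leq_ltn_trans md; lia.
- move=> y; rewrite inE => /andP[yN _].
  rewrite /r mulrAC; apply: ler_pM.
  + by rewrite divr_ge0// ltW.
  + rewrite ln_ge0// ler_pdivlMr// mul1r.
    have := @expR1_ge2 R; move: (expR 1) => e e2; nra.
  + rewrite ler_pdivrMr//; apply: (le_trans dmR).
    by rewrite mulrC ler_wpM2r// ler_nat; lia.
  (* It remains to see [e n / d <= 1 / p = n / (8 m)], which holds because [8 e m <= 32 m < d]. *)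
  rewrite ler_ln ?posrE ?invr_gt0 ?divr_gt0 ?mulr_gt0 ?expR_gt0//.
  rewrite /p invf_div ler_pdivrMr// mulrAC ler_pdivlMr; last by lra.
  rewrite [leLHS](_ : _ = n%:R * (expR 1 * (8 * m%:R))); last by ring.
  by rewrite ler_wpM2l//; have := @expR1_le4 R; nra.
have h0 : 0 < 2^-1 :> R by lra.
have low : \sum_(y : n.-tuple bool | (nfalse y <= 2 * m)%N)
    label_weight p y <= 4^-1 :> R.
  pose b : R := 2^-1 ^+ (2 * m)%N.
  have b0 : 0 < b by rewrite exprn_gt0.
  have bQ : forall y : n.-tuple bool, (nfalse y <= 2 * m)%N ->
      b <= 2^-1 ^+ nfalse y.
    by move=> y yN; apply: ler_wiXn2l => //; lra.
  (* With [c = 1 / 2] the bound is [(4 / e ^ 4) ^ m], and [e > 2] gives [e ^ 4 >= 16]. *)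
  apply: le_trans (label_weight_chernoff p01 h0 b0 bQ) _.
  rewrite (_ : p * _ * _ = - 1 * (4 * m)%:R); last first.
    by rewrite mulrAC pn natrM; field.
  rewrite expRM_natr expRN /b -exprVn invrK.
  rewrite !exprM -exprMn (_ : 2 ^+ 2 = 4)//; last by rewrite -natrX.
  apply: (@le_trans _ _ (4^-1 ^+ m)); last first.
    by rewrite -[leRHS]expr1; apply: ler_wiXn2l => //; lra.
  rewrite lerXn2r ?nnegrE ?mulr_ge0 ?exprn_ge0 ?invr_ge0 ?expR_ge0//. 
  have : (expR 1)^-1 ^+ 4 <= 2^-1 ^+ 4 :> R.
    rewrite lerXn2r ?nnegrE ?invr_ge0 ?expR_ge0//.
    by rewrite lef_pV2 ?posrE ?expR_gt0// ltW// expR1_ge2.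
  by rewrite (_ : 2^-1 ^+ 4 = 16^-1) => [|]; [lra|field].
have high : \sum_(y : n.-tuple bool | (32 * m <= nfalse y)%N)
    label_weight p y <= 4^-1 :> R.
  pose b : R := 2 ^+ (32 * m)%N.
  have b0 : 0 < b by rewrite exprn_gt0.
  have bQ : forall y : n.-tuple bool, (32 * m <= nfalse y)%N ->
      b <= 2 ^+ nfalse y.
    by move=> y yN; apply: ler_weXn2l => //; lra.
  (* With [c = 2] the bound is [(e ^ 8 / 2 ^ 32) ^ m], and [e <= 4]. *)
  apply: le_trans (label_weight_chernoff p01 _ b0 bQ) _ => //.
  rewrite (_ : p * _ * _ = 1 * (8 * m)%:R); last first.
    by rewrite mulrAC pn natrM; ring.
  rewrite expRM_natr /b -exprVn !exprM -exprMn.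
  apply: (@le_trans _ _ (4^-1 ^+ m)); last first.
    by rewrite -[leRHS]expr1; apply: ler_wiXn2l => //; lra.
  rewrite lerXn2r ?nnegrE ?mulr_ge0 ?exprn_ge0 ?invr_ge0 ?expR_ge0//.
  apply: (@le_trans _ _ (2^-1 ^+ 32 * 4 ^+ 8)).
    rewrite ler_wpM2l ?exprn_ge0 ?invr_ge0//.
    by rewrite lerXn2r ?nnegrE ?expR_ge0 ?expR1_le4.
  rewrite (_ : 32 = 4 * 8)%N// exprM -exprMn -[leRHS]expr1.
  have -> : 2^-1 ^+ 4 * 4 = 4^-1 :> R by field.
  by apply: ler_wiXn2l => //; lra.
have BE : \sum_(y in B) label_weight p y =
    1 - \sum_(y | y \notin B) label_weight p y :> R.
  by rewrite -(@sum_label_weight R n p) (bigID (mem B) xpredT)/= addrK.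
have : \sum_(y | y \notin B) label_weight p y <=
    \sum_(y : n.-tuple bool | (nfalse y <= 2 * m)%N) label_weight p y +
    \sum_(y : n.-tuple bool | (32 * m <= nfalse y)%N) label_weight p y :> R.
  rewrite !(big_mkcond (fun y => _ (nfalse y) _)).
  rewrite !(big_mkcond (fun y => _ _ (nfalse y))).
  rewrite [leLHS]big_mkcond -big_split/=; apply: ler_sum => y _.
  have w0 := ltW (label_weight_gt0 y p01).
  rewrite inE negb_and -!ltnNge.
  have [/ltnW ->|_] := ltnP (nfalse y) (2 * m); first
    by case: ifP; rewrite ?lerDl ?addr0.
  have [/ltnW ->|_] /= := ltnP (32 * m) (nfalse y); first
    by case: ifP; rewrite ?lerDr ?add0r.
  by case: ifP; case: ifP; rewrite ?addr_ge0.
suff : (expR 1)^-1 < 2^-1 :> R by rewrite BE; lra.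
by rewrite ltf_pV2 ?posrE ?expR_gt0// expR1_ge2.
Qed.

End rare_labels.

(** * Lower bounds *)

Section moment_design.
Context {R : realType} {n d : nat}.
Hypothesis d1 : (1 < d)%N.

Definition intercept (a : R) : d.-tuple R :=
  [tuple if j == 0%N :> nat then a else 0 | j < d].

Lemma dot_moment_intercept (t a : R) : dot (moment t) (intercept a) = a.
Proof.
rewrite /dot (bigD1 (Ordinal (ltnW d1)))//= big1 => [|j j0].
  by rewrite !tnth_mktuple expr0 mul1r addr0.
rewrite !tnth_mktuple ifF ?mulr0//.
by apply/eqP => j0'; move/eqP: j0; apply; exact: val_inj.
Qed.

Lemma likelihood_intercept (p : R) (x : n.-tuple (d.-tuple R)) y :
  0 < p < 1 -> moment_samples d1 x ->
  likelihood (intercept (ln ((1 - p) / p))) x y = label_weight p y.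
Proof.
move=> /andP[p0 p1] /moment_samplesP[t _ xt]; apply: eq_bigr => i _.
rewrite xt dot_moment_intercept sigmoid_label.
rewrite (_ : (1 - p) / p = (1 - p) / (1 - (1 - p))); last by rewrite subKr.
by rewrite sigmoid_logit ?subKr//; lra.
Qed.

Variables (p z : R) (B : {set n.-tuple bool}).
Hypothesis p01 : 0 < p < 1.
Hypothesis Bsep : forall (x : n.-tuple (d.-tuple R)) y,
  moment_samples d1 x -> y \in B ->
  exists theta, forall i, 0 < label (tnth y i) * dot (tnth x i) theta.
Hypothesis Bz : forall y, y \in B -> z <= - ln (label_weight p y).

Let theta := intercept (ln ((1 - p) / p)).

Let sum_likelihood_B (x : n.-tuple (d.-tuple R)) : moment_samples d1 x ->
  \sum_(y in B) likelihood theta x y = \sum_(y in B) label_weight p y.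
Proof.
by move=> mx; apply: eq_bigr => y _; exact: likelihood_intercept.
Qed.

Let log_lr_B (x : n.-tuple (d.-tuple R)) y : moment_samples d1 x -> y \in B ->
  z <= log_lr theta x y.
Proof.
move=> mx yB; have [theta' sep] := Bsep mx yB.
apply: le_trans (Bz yB) _; rewrite -(likelihood_intercept y p01 mx).
exact: log_lr_separable sep.
Qed.

Lemma le_Q_RD_moment delta : delta < \sum_(y in B) label_weight p y ->
  (z%:E <= @Q_RD R n d (1 - delta))%E.
Proof.
exact: (le_Q_RD (measurable_moment_samples d1 (n:=n))
  (prod_tuple_moment_samples d1 n) sum_likelihood_B log_lr_B).
Qed.

Lemma le_E_RD_moment : 0 <= z ->
  ((z * \sum_(y in B) label_weight p y)%:E <= @E_RD R n d)%E.
Proof.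
exact: (le_E_RD (measurable_moment_samples d1 (n:=n))
  (prod_tuple_moment_samples d1 n) sum_likelihood_B log_lr_B).
Qed.

End moment_design.

Section lower_bounds.
Context {R : realType} (n d : nat).
Hypotheses (d3 : (3 <= d)%N) (dn : (d <= n)%N).

Let r : R := d%:R * ln (expR 1 * n%:R / d%:R).

Let d1 : (1 < d)%N. Proof. exact: leq_trans d3. Qed.

(** The event [B] has probability above [1 / e], hence above every admissible [delta]; the same
    bound yields the factor [1 / e] for the mean. *)
Lemma rare_labels_lower_bound :
  (forall delta, delta <= (expR 1)^-1 ->
    ((r / 128)%:E <= @Q_RD R n d (1 - delta))%E) /\
  ((r / 128 / expR 1)%:E <= @E_RD R n d)%E.
Proof.
have [p [B [p01 Bd Br Be]]] : exists (p : R) (B : {set n.-tuple bool}),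
   [/\ 0 < p < 1,
    forall y, y \in B -> ((nfalse y).*2 < d)%N,
    forall y, y \in B -> r / 128 <= (nfalse y)%:R * ln p^-1 &
    (expR 1)^-1 < \sum_(y in B) label_weight p y].
  case: (leqP d 64) => ?; first exact: rare_labels_small.
  exact: rare_labels_large.
have Bsep (x : n.-tuple (d.-tuple R)) y : moment_samples d1 x -> y \in B ->
    exists theta, forall i, 0 < label (tnth y i) * dot (tnth x i) theta.
  by move=> /moment_samplesP[t tinj xt] /Bd; exact: moment_separable tinj xt.
have Bz y : y \in B -> r / 128 <= - ln (label_weight p y).
  have /andP[p0 _] := p01; move=> /Br/le_trans; apply.
  rewrite lnV ?posrE// mulrN lerN2 mulr_natl -lnXn// ler_ln ?posrE ?exprn_gt0//.
    exact: label_weight_le.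
  exact: label_weight_gt0.
have r0 : 0 <= r / 128.
  have d0 : 0 < d%:R :> R by rewrite ltr0n (leq_trans _ d3).
  have dnR : d%:R <= n%:R :> R by rewrite ler_nat.
  rewrite divr_ge0 ?mulr_ge0 ?ln_ge0// ler_pdivlMr// mul1r.
  by have := @expR1_ge2 R; nra.
split => [delta de|]; first
  exact: le_Q_RD_moment p01 Bsep Bz _ (le_lt_trans de Be).
apply: le_trans (le_E_RD_moment p01 Bsep Bz r0).
by rewrite lee_fin ler_wpM2l// ltW.
Qed.

Lemma all_false_lower_bound (delta : R) : 0 < delta -> delta <= (expR 1)^-1 ->
  ((ln (1 / delta) / 2)%:E <= @Q_RD R n d (1 - delta))%E.
Proof.
move=> delta0 deltae; have n0 : (0 < n)%N.
  by rewrite (leq_trans _ dn)// ltnW// ltnW.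
have n0R : 0 < n%:R :> R by rewrite ltr0n.
have ln_delta : ln delta <= -1.
  by rewrite -[leRHS]expRK ler_ln ?posrE ?expR_gt0// expRN.
(* Then [p ^ n = delta * exp (1 / 2)] exceeds [delta], and [p < 1] because [ln delta <= -1]. The
   loss of [1 / 2] is at most half of [ln (1 / delta)]. *)
pose p : R := expR ((ln delta + 2^-1) / n%:R).
have p01 : 0 < p < 1.
  rewrite expR_gt0/= -[ltRHS]expR0 ltr_expR pmulr_llt0 ?invr_gt0//.
  by lra.
pose y0 : n.-tuple bool := [tuple of nseq n false].
have y0E i : tnth y0 i = false by rewrite (tnth_nth false) nth_nseq if_same.
have wE : label_weight p y0 = expR (ln delta + 2^-1).
  transitivity (\prod_(i < n) p); first by apply: eq_bigr => i _; rewrite y0E.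
  by rewrite prodr_const card_ord /p -expRM_natr divfK// gt_eqF.
have Bsep (x : n.-tuple (d.-tuple R)) y :
    moment_samples d1 x -> y \in [set y0]%SET ->
    exists theta, forall i, 0 < label (tnth y i) * dot (tnth x i) theta.
  move=> /moment_samplesP[t _ xt]; rewrite inE => /eqP ->.
  (* When all labels are [false] a negative intercept separates them, although their number [n] is
     too large for the polynomial construction. *)
  exists (intercept (-1)) => i; rewrite xt dot_moment_intercept// y0E.
  by rewrite /label mulrNN mulr1.
have Bz y : y \in [set y0]%SET -> ln (1 / delta) / 2 <= - ln (label_weight p y).
  by rewrite inE => /eqP ->; rewrite wE expRK div1r lnV ?posrE//; lra.
apply: (le_Q_RD_moment p01 Bsep Bz); rewrite big_set1 wE expRD lnK ?posrE//.
by rewrite -[ltLHS]mulr1 ltr_pM2l// expR_gt1.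
Qed.

End lower_bounds.

(** * Combination of the upper and lower bounds *)

Theorem theorem2p1 (R : realType) :
  exists c C : R, [/\ 0 < c, c <= C &
    forall n d : nat, (3 <= d)%N -> (d <= n)%N ->
      let r : R := d%:R * ln (expR 1 * n%:R / d%:R) in
      [/\ (forall delta : R, 0 < delta -> delta <= 1 / expR 1 ->
            ((c * (r + ln (1 / delta)))%:E <= Q_RD n d (1 - delta)
               <= (C * (r + ln (1 / delta)))%:E)%E /\
            ((c * (r + ln (1 / delta)))%:E <= Q_FD n d (1 - delta)
               <= (C * (r + ln (1 / delta)))%:E)%E),
          ((c * r)%:E <= E_RD n d <= (C * r)%:E)%E &
          ((c * r)%:E <= E_FD n d <= (C * r)%:E)%E]].
Proof.
(* The constant [512 = 128 * 4] comes from the mean, with [e <= 4]. For the quantiles, the larger of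
   [r / 128] and [ln (1 / delta) / 2] dominates the sum over 512. *)
exists 512^-1, 1; split; [by lra|by lra|] => n d d3 dn r; rewrite [1 * r]mul1r.
have d0 : (0 < d)%N by rewrite (leq_trans _ d3).
have [] := @rare_labels_lower_bound R n d d3 dn; rewrite -/r => Qr Er.
have r0 : 0 <= r.
  have d0R : 0 < d%:R :> R by rewrite ltr0n.
  have dnR : d%:R <= n%:R :> R by rewrite ler_nat.
  rewrite mulr_ge0 ?ln_ge0// ler_pdivlMr// mul1r.
  by have := @expR1_ge2 R; nra.
have E_lower (e : \bar R) :
    ((r / 128 / expR 1)%:E <= e)%E -> ((512^-1 * r)%:E <= e)%E.
  apply: le_trans; rewrite lee_fin -mulrA mulrC ler_wpM2l//.
  rewrite -invfM lef_pV2 ?posrE ?mulr_gt0 ?expR_gt0//.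
  by have := @expR1_le4 R; lra.
split.
- move=> delta delta0 deltae'.
  have deltae : delta <= (expR 1)^-1 by move: deltae'; rewrite div1r.
  have delta1 : 0 <= 1 - delta.
    rewrite subr_ge0 (le_trans deltae)// invf_le1 ?expR_gt0//.
    by have := @expR1_ge2 R; lra.
  have l0 : 0 <= ln (1 / delta).
    by rewrite ln_ge0// ler_pdivlMr// mul1r -subr_ge0.
  have RD : ((512^-1 * (r + ln (1 / delta)))%:E <= @Q_RD R n d (1 - delta))%E.
    have [rl|rl] := leP (ln (1 / delta) / 2) (r / 128).
      by apply: le_trans (Qr _ deltae); rewrite lee_fin; lra.
    apply: le_trans (all_false_lower_bound d3 dn delta0 deltae).
    by rewrite lee_fin; lra.
  have FD := Q_RD_le_Q_FD delta1 RD.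
  by rewrite [1 * (_ + _)]mul1r RD FD Q_FD_le// Q_RD_le//; lra.
- by rewrite E_lower//= E_RD_le.
- by rewrite E_lower ?E_FD_le//; exact: E_RD_le_E_FD.
Qed.
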